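(* Let $$k(z)=\frac{4-z}{2-z}+\log\Bigl(\frac{2}{2-z}\Bigr),\qquad g_t(z)=(1-t)^{1/2}\,k^{-1}\Bigl(k(z)+\tfrac12\log(1-t)\Bigr),\quad 0\le t<1 .$$ Then $k$ is a conformal map of $\mathbb H$ onto $\mathbb H\setminus\{x+\pi i:x\le0\}$, and $g_t$ satisfies the Loewner equation $$\dot g_t=\frac{2}{g_t-4\sqrt{1-t}},\qquad g_0(z)\equiv z .$$ The trace $\gamma=k^{-1}(\{x+\pi i:x>0\})$ is a curve in $\mathbb H$ that begins at $4$, meeting $\mathbb R$ at right angles, and ends at $2$, where it is tangential to $\mathbb R$. The case $\kappa=-4$ (driving term $-4\sqrt{1-t}$) is obtained from the case $\kappa=4$ by reflecting about the imaginary axis.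
   Context: $\mathbb H$ is the upper half-plane. For $z\in\mathbb H$ one has $2/(2-z)\in\mathbb H$ and the logarithm is the branch with imaginary part in $(0,\pi)$. The map $g_t$ is defined on $\mathbb H\setminus\gamma((0,t])$, where $\gamma$ is parametrized by half-plane capacity (the hydrodynamically normalized map $g_t$ of $\mathbb H\setminus\gamma((0,t])$ onto $\mathbb H$ satisfies $g_t(z)=z+2t/z+O(1/z^2)$ at $\infty$), and the dot denotes $\partial/\partial t$. The trace $\gamma$ is the curve generating the hulls of the Loewner equation with driving term $\lambda(t)=4\sqrt{1-t}$. Reflection about the imaginary axis is $z\mapsto-\overline z$; it conjugates solutions with driving term $\lambda$ to those with driving term $-\lambda$. *)

(* Defs.v *)
From Stdlib Require Import Reals ClassicalEpsilon.
From Coquelicot Require Import Coquelicot.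
Open Scope R_scope.

Definition upper_half_plane (z : C) : Prop := 0 < Im z.

(** Polar form of the logarithm; on the upper half-plane [Re w / |w|] lies in
    (-1, 1), so that the imaginary part is the argument in (0, PI).
    It is only meant to be used there. *)
Definition Clog (w : C) : C := (ln (Cmod w), acos (Re w / Cmod w)).

Definition k (z : C) : C := ((4 - z) / (2 - z) + Clog (2 / (2 - z)))%C.

(** The inverse of [k] on the upper half-plane, unspecified off
    the image of [k]. *)
Definition k_inv (w : C) : C :=
  epsilon (inhabits (RtoC 0)) (fun z => upper_half_plane z /\ k z = w).

Definition g (t : R) (z : C) : C :=
  (RtoC (sqrt (1 - t)) * k_inv (k z + RtoC (1 / 2 * ln (1 - t))))%C.

Definition slit_half_plane (w : C) : Prop :=
  upper_half_plane w /\ ~ (exists x : R, x <= 0 /\ w = (RtoC x + PI * Ci)%C).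

Definition conformal_onto (f : C -> C) (U V : C -> Prop) : Prop :=
  (forall z, U z ->
     exists l : C, @is_derive C_AbsRing C_NormedModule f z l /\ l <> RtoC 0) /\
  (forall z1 z2, U z1 -> U z2 -> f z1 = f z2 -> z1 = z2) /\
  (forall w, V w <-> exists z, U z /\ f z = w).

(** Derivative of [u] at [t] along [D]: one-sided at an end point of [D]. *)
Definition is_derive_within (D : R -> Prop) (u : R -> C) (t : R) (l : C) : Prop :=
  @filterdiff R_AbsRing R_NormedModule C_R_NormedModule
    u (within D (locally t)) (fun h => scal h l).

Definition driving (kappa t : R) : R := kappa * sqrt (1 - t).

(** [u] solves the Loewner equation started at [z] on the closed interval [0, t]
    without meeting the driving term there. *)
Definition loewner_solution (lam : R -> R) (z : C) (t : R) (u : R -> C) : Prop :=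
  u 0 = z /\
  forall s, 0 <= s <= t ->
    u s <> RtoC (lam s) /\
    is_derive_within (fun r => 0 <= r <= t) u s (2 / (u s - RtoC (lam s)))%C.

(** The points whose life time under the Loewner flow is at most [t]. *)
Definition loewner_hull (lam : R -> R) (t : R) (z : C) : Prop :=
  upper_half_plane z /\ ~ (exists u, loewner_solution lam z t u).

Definition arc (gam : R -> C) (t : R) (z : C) : Prop :=
  exists s, 0 < s <= t /\ z = gam s.

Definition arc_complement (gam : R -> C) (t : R) (z : C) : Prop :=
  upper_half_plane z /\ ~ arc gam t z.

(** The curve [gam], on the time interval [0, 1), generates the hulls of the
    Loewner equation driven by [lam]. *)
Definition is_trace (lam : R -> R) (gam : R -> C) : Prop :=
  (forall t, 0 <= t < 1 ->
     filterlim gam (within (fun s => 0 <= s < 1) (locally t)) (locally (gam t))) /\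
  (forall t, 0 <= t < 1 -> forall z, loewner_hull lam t z <-> arc gam t z).

(** [f z = z + 2 t / z + O(1 / z^2)] as [z] tends to infinity in [U]. *)
Definition hydrodynamic (f : C -> C) (U : C -> Prop) (t : R) : Prop :=
  exists M r : R, 0 < r /\
    forall z, U z -> r <= Cmod z ->
      Cmod (f z - z - RtoC (2 * t) / z)%C <= M / Cmod z ^ 2.

(** [G t] is, for [0 <= t < 1], the normalized conformal map of the complement of
    [gam ((0, t])] onto the half-plane ([gam] being parametrized by half-plane
    capacity), and [G] satisfies the Loewner equation driven by [lam]. *)
Definition loewner_chain (lam : R -> R) (gam : R -> C) (G : R -> C -> C) : Prop :=
  (forall z, upper_half_plane z -> G 0 z = z) /\
  (forall t, 0 <= t < 1 ->
     conformal_onto (G t) (arc_complement gam t) upper_half_plane /\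
     hydrodynamic (G t) (arc_complement gam t) t /\
     forall z, arc_complement gam t z ->
       G t z <> RtoC (lam t) /\
       is_derive_within (fun s => 0 <= s < 1) (fun s => G s z) t
         (2 / (G t z - RtoC (lam t)))%C).

(** [d] is the limit, along [F], of the unit secant directions of [gam] from [p]. *)
Definition half_tangent (gam : R -> C) (F : (R -> Prop) -> Prop) (p d : C) : Prop :=
  filterlim (fun t => ((gam t - p) / RtoC (Cmod (gam t - p)))%C) F (locally d).

Definition reflect (z : C) : C := (- Cconj z)%C.

(* Main.v *)
Require Import Defs.
From Stdlib Require Import Reals ClassicalEpsilon Classical Lra.
From Coquelicot Require Import Coquelicot.
Open Scope R_scope.

(** In the coordinate [w = 2 / (2 - z)], which maps the half-plane onto itself,
    [k] becomes [Kw w = 1 + w + log w].  Its derivative [1 + 1 / w] has negative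
    imaginary part on the half-plane, so the Noshiro-Warschawski argument
    ([noshiro_segment]) makes [Kw] injective; in the quantitative form used here
    ([Kw_separates]) it also makes the inverse continuous, hence differentiable.
    The points that [Kw] sends to the line [Im = v] form a curve parametrized by
    the argument [y], with modulus [(v - y) / sin y], and the intermediate value
    theorem along it yields every point of the slit half-plane ([Kw_onto]).

    The Loewner equation with driving term [4 sqrt (1 - t)] is self-similar: in
    [u / sqrt (1 - t)] it becomes autonomous, and [k] turns it into the
    translation by [shift t = ln (1 - t) / 2].  Differentiating the formula
    for [g] gives the equation ([g_loewner]) as long as the translated point
    stays off the slit.  Conversely [k (u / sqrt (1 - s)) - shift s] is
    constant along any solution [u] ([k_conserved]), and a
    solution cannot leave the half-plane ([loewner_solution_upper]).  If
    [k z = x + PI i] with [x > 0], at the time [s] with [shift s = - x] a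
    solution would provide a point that [k] maps to [PI i], a value that [k]
    omits.  Hence the hull at time [t] is the [k]-preimage of
    the part [0 < x <= - shift t] of the ray ([hull_4]), which is the arc up to
    time [t] of the curve [trace_4].  A trace is determined by its arcs
    ([trace_unique]), so [trace_4] is the only one on [[0, 1)].

    On the ray the parameter [th = Im w] gives
    [z = 2 + (exp (2 i th) - 1) / (i th)], where [- shift t = ray_height th] is
    increasing from [0] to infinity on [(0, PI)].  The limits and tangents at [4]
    ([th] tends to [0]) and at [2] ([th] tends to [PI]) are read off from this
    formula.  The expansion of [g] at infinity comes from the differential
    equation: when [z] is far from the driving term the orbit stays within
    distance [1] of [z] ([g_stays_near]), so that the velocity is
    [2 / z + O (1 / |z|^2)].  The case of the opposite driving term follows since
    reflection conjugates solutions, hulls and chains. *)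

(** * Differentiation along a filter *)

Lemma locally_Cmod (z : C) (P : C -> Prop) :
  locally z P <-> exists d, 0 < d /\ forall x, Cmod (x - z) < d -> P x.
Proof.
  split.
  - intros H.
    destruct (@locally_norm_le_locally R_AbsRing C_R_NormedModule z P H) as [d Hd].
    exists d; split; [apply cond_pos|].
    intros x Hx; apply Hd; unfold ball_norm; rewrite <- Cmod_norm; exact Hx.
  - intros [d [Hd H]].
    apply (@locally_le_locally_norm R_AbsRing C_R_NormedModule z P).
    exists (mkposreal d Hd); intros x Hx; apply H.
    unfold ball_norm in Hx; rewrite <- Cmod_norm in Hx; exact Hx.
Qed.

Lemma filterlim_Cmod {T : Type} (F : (T -> Prop) -> Prop) {FF : Filter F}
  (f : T -> C) (a : C) :
  filterlim f F (locally a) <->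
  forall eps, 0 < eps -> F (fun x => Cmod (f x - a) < eps).
Proof.
  split.
  - intros H eps He. apply (H (fun y => Cmod (y - a) < eps)).
    apply locally_Cmod. exists eps; auto.
  - intros H P HP. apply locally_Cmod in HP. destruct HP as [d [Hd HP]].
    unfold filtermap. generalize (H d Hd). apply filter_imp. intros x; apply HP.
Qed.

(** A common form of the complex derivative at [z] ([p x = x - z] along
    [locally z]) and of the derivative of a curve within a set [D]
    ([p s = RtoC (s - t)] along [within D (locally t)]), so that one proof of each
    rule serves both.  The value [a] is explicit because [f] need not be
    evaluated at the limit point of the filter. *)
Definition deriv_along {T : Type} (F : (T -> Prop) -> Prop) (p f : T -> C)
  (a l : C) : Prop :=
  forall eps, 0 < eps ->
    F (fun x => Cmod (f x - a - l * p x) <= eps * Cmod (p x)).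

Definition vanishing {T : Type} (F : (T -> Prop) -> Prop) (p : T -> C) : Prop :=
  forall eps, 0 < eps -> F (fun x => Cmod (p x) < eps).

Definition complex_deriv (f : C -> C) (z l : C) : Prop :=
  deriv_along (locally z) (fun x => x - z)%C f (f z) l.

Definition deriv_within (D : R -> Prop) (u : R -> C) (t : R) (l : C) : Prop :=
  deriv_along (within D (locally t)) (fun s => RtoC (s - t)) u (u t) l.

Lemma vanishing_locally (z : C) : vanishing (locally z) (fun x => x - z)%C.
Proof. intros eps He; apply locally_Cmod; exists eps; auto. Qed.

Lemma vanishing_within (D : R -> Prop) (t : R) :
  vanishing (within D (locally t)) (fun s => RtoC (s - t)).
Proof.
  intros eps He. exists (mkposreal eps He). intros s Hs _.
  rewrite Cmod_R. exact Hs.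
Qed.

Lemma deriv_along_bound {T : Type} (F : (T -> Prop) -> Prop) {FF : Filter F}
  (p f : T -> C) (a l : C) :
  deriv_along F p f a l ->
  F (fun x => Cmod (f x - a) <= (1 + Cmod l) * Cmod (p x)).
Proof.
  intros H. generalize (H 1 Rlt_0_1). apply filter_imp. intros x Hx.
  replace (f x - a)%C with ((f x - a - l * p x) + l * p x)%C by ring.
  eapply Rle_trans; [apply Cmod_triangle|]. rewrite Cmod_mult. lra.
Qed.

Lemma deriv_along_cont {T : Type} (F : (T -> Prop) -> Prop) {FF : Filter F}
  (p f : T -> C) (a l : C) :
  vanishing F p -> deriv_along F p f a l ->
  forall eps, 0 < eps -> F (fun x => Cmod (f x - a) < eps).
Proof.
  intros Hp H eps He.
  assert (Hl := Cmod_ge_0 l).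
  assert (He' : 0 < eps / (1 + Cmod l)) by (apply Rdiv_lt_0_compat; lra).
  generalize (filter_and _ _ (deriv_along_bound F p f a l H) (Hp _ He')).
  apply filter_imp. intros x [H1 H2].
  eapply Rle_lt_trans; [exact H1|].
  replace eps with ((1 + Cmod l) * (eps / (1 + Cmod l))) by (field; lra).
  apply Rmult_lt_compat_l; lra.
Qed.

Lemma deriv_along_ext {T : Type} (F : (T -> Prop) -> Prop) {FF : Filter F}
  (p f f' : T -> C) (a l l' : C) :
  F (fun x => f x = f' x) -> l = l' ->
  deriv_along F p f a l -> deriv_along F p f' a l'.
Proof.
  intros E <- H eps He. generalize (filter_and _ _ E (H eps He)).
  apply filter_imp. intros x [-> Hx]; exact Hx.
Qed.

Lemma deriv_along_const {T : Type} (F : (T -> Prop) -> Prop) {FF : Filter F}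
  (p : T -> C) (a : C) : deriv_along F p (fun _ => a) a (RtoC 0).
Proof.
  intros eps He. apply filter_forall. intros x.
  replace (a - a - 0 * p x)%C with (RtoC 0) by ring. rewrite Cmod_0.
  apply Rmult_le_pos; [lra|apply Cmod_ge_0].
Qed.

Lemma deriv_along_id {T : Type} (F : (T -> Prop) -> Prop) {FF : Filter F}
  (p : T -> C) (f : T -> C) (a : C) :
  (forall x, f x = a + p x)%C -> deriv_along F p f a (RtoC 1).
Proof.
  intros E eps He. apply filter_forall. intros x. rewrite E.
  replace (a + p x - a - 1 * p x)%C with (RtoC 0) by ring. rewrite Cmod_0.
  apply Rmult_le_pos; [lra|apply Cmod_ge_0].
Qed.

Lemma deriv_along_plus {T : Type} (F : (T -> Prop) -> Prop) {FF : Filter F}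
  (p f1 f2 : T -> C) (a1 a2 l1 l2 : C) :
  deriv_along F p f1 a1 l1 -> deriv_along F p f2 a2 l2 ->
  deriv_along F p (fun x => f1 x + f2 x)%C (a1 + a2)%C (l1 + l2)%C.
Proof.
  intros H1 H2 eps He.
  assert (He' : 0 < eps / 2) by lra.
  generalize (filter_and _ _ (H1 _ He') (H2 _ He')). apply filter_imp.
  intros x [K1 K2].
  replace (f1 x + f2 x - (a1 + a2) - (l1 + l2) * p x)%C
    with ((f1 x - a1 - l1 * p x) + (f2 x - a2 - l2 * p x))%C by ring.
  eapply Rle_trans; [apply Cmod_triangle|]. lra.
Qed.

Lemma deriv_along_comp {T : Type} (F : (T -> Prop) -> Prop) {FF : Filter F}
  (p f : T -> C) (phi : C -> C) (a l m : C) :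
  vanishing F p -> complex_deriv phi a m -> deriv_along F p f a l ->
  deriv_along F p (fun x => phi (f x)) (phi a) (m * l)%C.
Proof.
  intros Hp Hphi Hf eps He.
  assert (Hm := Cmod_ge_0 m). assert (Hl := Cmod_ge_0 l).
  set (e1 := eps / (2 * (1 + Cmod l))).
  assert (He1 : 0 < e1) by (apply Rdiv_lt_0_compat; lra).
  set (e2 := eps / (2 * (1 + Cmod m))).
  assert (He2 : 0 < e2) by (apply Rdiv_lt_0_compat; lra).
  destruct (proj1 (locally_Cmod _ _) (Hphi e1 He1)) as [d [Hd K]].
  generalize (filter_and _ _ (deriv_along_cont F p f a l Hp Hf d Hd)
    (filter_and _ _ (Hf e2 He2) (deriv_along_bound F p f a l Hf))).
  apply filter_imp. intros x [K1 [K2 K3]].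
  replace (phi (f x) - phi a - m * l * p x)%C
    with ((phi (f x) - phi a - m * (f x - a)) + m * (f x - a - l * p x))%C by ring.
  eapply Rle_trans; [apply Cmod_triangle|]. rewrite Cmod_mult.
  specialize (K _ K1). cbv beta in K.
  assert (Hpx := Cmod_ge_0 (p x)).
  assert (B1 : e1 * Cmod (f x - a) <= eps / 2 * Cmod (p x)).
  { replace (eps / 2) with (e1 * (1 + Cmod l)) by (unfold e1; field; lra).
    rewrite Rmult_assoc. apply Rmult_le_compat_l; lra. }
  assert (B2 : Cmod m * Cmod (f x - a - l * p x) <= eps / 2 * Cmod (p x)).
  { replace (eps / 2) with ((1 + Cmod m) * e2) by (unfold e2; field; lra).
    rewrite Rmult_assoc. apply Rmult_le_compat; try lra; apply Cmod_ge_0. }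
  lra.
Qed.

Lemma complex_deriv_square (a : C) : complex_deriv (fun z => z * z)%C a (2 * a)%C.
Proof.
  intros eps He. generalize (vanishing_locally a eps He). apply filter_imp.
  intros x Hx. cbv beta.
  replace (x * x - a * a - 2 * a * (x - a))%C with ((x - a) * (x - a))%C by ring.
  rewrite Cmod_mult. apply Rmult_le_compat_r; [apply Cmod_ge_0|lra].
Qed.

Lemma deriv_along_scal {T : Type} (F : (T -> Prop) -> Prop) {FF : Filter F}
  (p f : T -> C) (a l c : C) :
  deriv_along F p f a l ->
  deriv_along F p (fun x => c * f x)%C (c * a)%C (c * l)%C.
Proof.
  intros H eps He.
  assert (Hc := Cmod_ge_0 c).
  assert (He' : 0 < eps / (1 + Cmod c)) by (apply Rdiv_lt_0_compat; lra).
  generalize (H _ He'). apply filter_imp. intros x Hx.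
  replace (c * f x - c * a - c * l * p x)%C with (c * (f x - a - l * p x))%C by ring.
  rewrite Cmod_mult.
  replace eps with ((1 + Cmod c) * (eps / (1 + Cmod c))) by (field; lra).
  rewrite Rmult_assoc. apply Rmult_le_compat; try lra; apply Cmod_ge_0.
Qed.

Lemma deriv_along_minus {T : Type} (F : (T -> Prop) -> Prop) {FF : Filter F}
  (p f1 f2 : T -> C) (a1 a2 l1 l2 : C) :
  deriv_along F p f1 a1 l1 -> deriv_along F p f2 a2 l2 ->
  deriv_along F p (fun x => f1 x - f2 x)%C (a1 - a2)%C (l1 - l2)%C.
Proof.
  intros H1 H2.
  assert (H := deriv_along_plus F p _ _ _ _ _ _ H1
                 (deriv_along_scal F p _ _ _ (- RtoC 1)%C H2)).
  replace (a1 - a2)%C with (a1 + (- RtoC 1) * a2)%C by ring.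
  revert H. apply deriv_along_ext; auto.
  - apply filter_forall. intros x. ring.
  - ring.
Qed.

(** Polarization reduces the product rule to the derivative of the square. *)
Lemma deriv_along_mult {T : Type} (F : (T -> Prop) -> Prop) {FF : Filter F}
  (p f1 f2 : T -> C) (a1 a2 l1 l2 : C) :
  vanishing F p ->
  deriv_along F p f1 a1 l1 -> deriv_along F p f2 a2 l2 ->
  deriv_along F p (fun x => f1 x * f2 x)%C (a1 * a2)%C (a1 * l2 + l1 * a2)%C.
Proof.
  intros Hp H1 H2.
  assert (Hs := deriv_along_comp F p _ _ _ _ _ Hp (complex_deriv_square _)
                  (deriv_along_plus F p _ _ _ _ _ _ H1 H2)).
  assert (Hd := deriv_along_comp F p _ _ _ _ _ Hp (complex_deriv_square _)
                  (deriv_along_minus F p _ _ _ _ _ _ H1 H2)).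
  assert (H := deriv_along_scal F p _ _ _ (/ 4)%C
                 (deriv_along_minus F p _ _ _ _ _ _ Hs Hd)).
  assert (N : RtoC 4 <> RtoC 0) by (intros E; apply RtoC_inj in E; lra).
  replace (a1 * a2)%C
    with (/ 4 * ((a1 + a2) * (a1 + a2) - (a1 - a2) * (a1 - a2)))%C by (field; auto).
  revert H. apply deriv_along_ext.
  - exact FF.
  - apply filter_forall. intros x. field; auto.
  - field; auto.
Qed.

Lemma Cmod_sub_ge (x y : C) : Cmod x - Cmod y <= Cmod (x - y).
Proof.
  assert (H := Cmod_triangle (x - y) y).
  replace (x - y + y)%C with x in H by ring. lra.
Qed.

Lemma complex_deriv_inv (a : C) :
  a <> RtoC 0 -> complex_deriv Cinv a (- / (a * a))%C.
Proof.
  intros Ha eps He.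
  assert (Ha' := proj1 (Cmod_gt_0 a) Ha). set (r := Cmod a) in *.
  set (d := Rmin (r / 2) (eps * (r * r * r) / 2)).
  assert (Hr3 : 0 < r * r * r) by (repeat apply Rmult_lt_0_compat; lra).
  assert (Hd : 0 < d).
  { apply Rmin_pos; [lra|]. apply Rdiv_lt_0_compat; [|lra].
    apply Rmult_lt_0_compat; lra. }
  generalize (vanishing_locally a d Hd). apply filter_imp.
  intros x Hx. cbv beta.
  assert (Hx1 : Cmod (x - a) < r / 2) by (eapply Rlt_le_trans; [exact Hx|apply Rmin_l]).
  assert (Hx2 : Cmod (x - a) < eps * (r * r * r) / 2)
    by (eapply Rlt_le_trans; [exact Hx|apply Rmin_r]).
  assert (Hxm : r / 2 < Cmod x).
  { assert (H := Cmod_sub_ge a x).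
    replace (a - x)%C with (- (x - a))%C in H by ring.
    rewrite Cmod_opp in H. fold r in H. lra. }
  assert (Hx0 : x <> RtoC 0) by (apply Cmod_gt_0; lra).
  replace (/ x - / a - - / (a * a) * (x - a))%C
    with ((x - a) / (x * (a * a)) * (x - a))%C by (field; split; auto).
  rewrite Cmod_mult. apply Rmult_le_compat_r; [apply Cmod_ge_0|].
  rewrite Cmod_div by (repeat apply Cmult_neq_0; auto).
  rewrite !Cmod_mult. fold r.
  apply Rmult_le_reg_r with (Cmod x * (r * r)).
  { repeat apply Rmult_lt_0_compat; lra. }
  unfold Rdiv at 1. rewrite Rmult_assoc, Rinv_l, Rmult_1_r.
  2:{ assert (0 < Cmod x * (r * r)) by (repeat apply Rmult_lt_0_compat; lra). lra. }
  apply Rle_trans with (eps * (r / 2 * (r * r))); [lra|].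
  apply Rmult_le_compat_l; [lra|]. apply Rmult_le_compat_r; [nra|lra].
Qed.

Lemma deriv_along_inv {T : Type} (F : (T -> Prop) -> Prop) {FF : Filter F}
  (p f : T -> C) (a l : C) :
  vanishing F p -> a <> RtoC 0 -> deriv_along F p f a l ->
  deriv_along F p (fun x => / f x)%C (/ a)%C (- (l / (a * a)))%C.
Proof.
  intros Hp Ha H.
  assert (K := deriv_along_comp F p _ _ _ _ _ Hp (complex_deriv_inv a Ha) H).
  revert K. apply deriv_along_ext; auto.
  - apply filter_forall; reflexivity.
  - field; auto.
Qed.

(** Continuity of [h] makes its increment small enough for the expansion of [f] at
    [h w] to be solved for it. *)
Lemma complex_deriv_inverse (f h : C -> C) (w l : C) :
  complex_deriv f (h w) l -> l <> RtoC 0 ->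
  filterlim h (locally w) (locally (h w)) ->
  locally w (fun v => f (h v) = v) ->
  complex_deriv h w (/ l)%C.
Proof.
  intros Hf Hl Hc Hinv eps He.
  assert (Hl' := proj1 (Cmod_gt_0 l) Hl). set (r := Cmod l) in *.
  assert (Hw : f (h w) = w).
  { apply locally_Cmod in Hinv. destruct Hinv as [d [Hd K]]. apply K.
    replace (w - w)%C with (RtoC 0) by ring. rewrite Cmod_0; lra. }
  set (e := Rmin (r / 2) (eps * (r * r) / 2)).
  assert (Hr2 : 0 < r * r) by nra.
  assert (He' : 0 < e).
  { apply Rmin_pos; [lra|]. apply Rdiv_lt_0_compat; [|lra].
    apply Rmult_lt_0_compat; lra. }
  generalize (filter_and _ _ Hinv (Hc _ (Hf e He'))). apply filter_imp.
  intros v [E K]. cbv beta in K. rewrite E, Hw in K.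
  assert (e1 : e <= r / 2) by apply Rmin_l.
  assert (e2 : e <= eps * (r * r) / 2) by apply Rmin_r.
  set (D := (h v - h w)%C) in *.
  assert (HD := Cmod_ge_0 D).
  assert (KD : r * Cmod D <= 2 * Cmod (v - w)).
  { assert (T1 := Cmod_sub_ge (l * D) (v - w)).
    replace (l * D - (v - w))%C with (- (v - w - l * D))%C in T1 by ring.
    rewrite Cmod_opp, Cmod_mult in T1. fold r in T1.
    assert (e * Cmod D <= r / 2 * Cmod D) by (apply Rmult_le_compat_r; lra). lra. }
  replace (D - / l * (v - w))%C with (- (/ l * (v - w - l * D)))%C by (field; auto).
  rewrite Cmod_opp, Cmod_mult, Cmod_inv by auto. fold r.
  apply Rmult_le_reg_l with r; [lra|].
  rewrite <- Rmult_assoc, Rinv_r, Rmult_1_l by lra.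
  apply Rle_trans with (1 := K).
  apply Rle_trans with (eps * (r * r) / 2 * Cmod D); [apply Rmult_le_compat_r; lra|].
  replace (eps * (r * r) / 2 * Cmod D) with (eps * r / 2 * (r * Cmod D)) by field.
  replace (r * (eps * Cmod (v - w))) with (eps * r / 2 * (2 * Cmod (v - w))) by field.
  apply Rmult_le_compat_l; [|lra]. assert (0 < eps * r) by (apply Rmult_lt_0_compat; lra). lra.
Qed.

Lemma complex_deriv_is_derive (f : C -> C) (z l : C) :
  complex_deriv f z l <-> @is_derive C_AbsRing C_NormedModule f z l.
Proof.
  split.
  - intros H. split.
    + apply (@is_linear_scal_l C_AbsRing C_NormedModule).
    + intros x Hx.
      assert (E : z = x).
      { apply (@is_filter_lim_locally_unique C_AbsRing
          (AbsRing_NormedModule C_AbsRing)). exact Hx. }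
      subst x. intros eps.
      apply locally_C.
      generalize (H eps (cond_pos eps)). apply filter_imp. intros y Hy.
      change (Cmod (f y - f z - (y - z) * l) <= eps * Cmod (y - z)).
      replace ((y - z) * l)%C with (l * (y - z))%C by ring. exact Hy.
  - intros [_ H] eps He.
    assert (Hz : is_filter_lim (locally (T := AbsRing_UniformSpace C_AbsRing) z) z).
    { intros P HP; exact HP. }
    generalize (H z Hz (mkposreal eps He)). intros K.
    apply locally_C in K. revert K. apply filter_imp. intros y Hy.
    change (Cmod (f y - f z - (y - z) * l) <= eps * Cmod (y - z)) in Hy.
    replace ((y - z) * l)%C with (l * (y - z))%C in Hy by ring. exact Hy.
Qed.

Lemma deriv_within_is_derive_within (D : R -> Prop) (u : R -> C) (t : R) (l : C) :
  D t -> (deriv_within D u t l <-> is_derive_within D u t l).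
Proof.
  intros HD.
  assert (E : forall s,
    @minus C_R_NormedModule (minus (u s) (u t)) (scal (minus s t) l)
    = (u s - u t - l * RtoC (s - t))%C).
  { intros s. rewrite scal_R_Cmult.
    change (u s - u t - RtoC (s - t) * l = u s - u t - l * RtoC (s - t))%C. ring. }
  split.
  - intros H. split.
    + apply (@is_linear_scal_l R_AbsRing C_R_NormedModule).
    + intros x Hx.
      assert (Ex : x = t).
      { destruct (Req_dec x t) as [|N]; [assumption|exfalso].
        assert (Hd : 0 < Rabs (t - x)) by (apply Rabs_pos_lt; lra).
        assert (K : locally x (fun y => Rabs (y - x) < Rabs (t - x))).
        { exists (mkposreal _ Hd). intros y Hy; exact Hy. }
        apply Hx in K. destruct K as [d K].
        specialize (K t (ball_center t d) HD). lra. }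
      subst x. intros eps.
      generalize (H eps (cond_pos eps)). apply filter_imp. intros s Hs.
      rewrite Cmod_R, <- E, Cmod_norm in Hs. exact Hs.
  - intros [_ H] eps He.
    assert (Ht : is_filter_lim (within D (locally t)) t).
    { intros P HP. apply filter_le_within. exact HP. }
    generalize (H t Ht (mkposreal eps He)). apply filter_imp. intros s Hs.
    rewrite Cmod_R, <- E, Cmod_norm. exact Hs.
Qed.

Lemma re_minus (a b : C) : Re (a - b) = Re a - Re b.
Proof. reflexivity. Qed.

Lemma im_minus (a b : C) : Im (a - b) = Im a - Im b.
Proof. reflexivity. Qed.

Lemma is_derive_deriv_within (D : R -> Prop) (f : R -> R) (t l : R) :
  is_derive f t l -> deriv_within D (fun s => RtoC (f s)) t (RtoC l).
Proof.
  intros H eps He.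
  apply is_derive_Reals in H. destruct (H eps He) as [d Hd].
  exists d. change (forall s : R, Rabs (s - t) < d -> D s ->
    Cmod (RtoC (f s) - RtoC (f t) - RtoC l * RtoC (s - t)) <= eps * Cmod (RtoC (s - t))).
  intros s Hs _.
  rewrite <- RtoC_mult, <- !RtoC_minus, !Cmod_R.
  destruct (Req_dec s t) as [->|N].
  - replace (f t - f t - l * (t - t)) with 0 by ring.
    replace (t - t) with 0 by ring. rewrite Rabs_R0; lra.
  - assert (N' : s - t <> 0) by lra.
    specialize (Hd _ N' Hs). replace (t + (s - t)) with s in Hd by ring.
    replace (f s - f t - l * (s - t)) with (((f s - f t) / (s - t) - l) * (s - t))
      by (field; exact N').
    rewrite Rabs_mult. apply Rmult_le_compat_r; [apply Rabs_pos|lra].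
Qed.

Lemma deriv_within_var (D : R -> Prop) (t : R) :
  deriv_within D RtoC t (RtoC 1).
Proof.
  apply deriv_along_id; [typeclasses eauto|]. intros s.
  rewrite <- RtoC_plus. f_equal. ring.
Qed.

Lemma deriv_within_subset (D D' : R -> Prop) (u : R -> C) (t : R) (l : C) :
  (forall s, D' s -> D s) -> deriv_within D u t l -> deriv_within D' u t l.
Proof.
  intros HD H eps He. generalize (H eps He). unfold within. apply filter_imp.
  intros s Hs K; apply Hs, HD, K.
Qed.

Lemma im_le_Cmod (z : C) : Rabs (Im z) <= Cmod z.
Proof. eapply Rle_trans; [apply Rmax_r|apply Rmax_Cmod]. Qed.

Lemma deriv_within_cont (D : R -> Prop) (u : R -> C) (t : R) (l : C) :
  deriv_within D u t l ->
  forall eps, 0 < eps -> exists d, 0 < d /\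
    forall s, D s -> Rabs (s - t) < d -> Cmod (u s - u t) < eps.
Proof.
  intros H eps He.
  destruct (deriv_along_cont _ _ _ _ _ (vanishing_within D t) H eps He) as [d K].
  exists d; split; [apply cond_pos|]. intros s Hs Hd. apply K; assumption.
Qed.

(** * Mean value theorems on an interval *)

Definition clamp (a b s : R) : R := Rmax a (Rmin b s).

Lemma clamp_in (a b s : R) : a <= b -> a <= clamp a b s <= b.
Proof.
  intros H. unfold clamp, Rmax, Rmin.
  destruct (Rle_dec b s); destruct (Rle_dec a _); lra.
Qed.

Lemma clamp_id (a b s : R) : a <= s <= b -> clamp a b s = s.
Proof.
  intros H. unfold clamp, Rmax, Rmin.
  destruct (Rle_dec b s); destruct (Rle_dec a _); lra.
Qed.

Lemma clamp_lipschitz (a b s r : R) :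
  Rabs (clamp a b s - clamp a b r) <= Rabs (s - r).
Proof.
  unfold clamp, Rmax, Rmin.
  destruct (Rle_dec b s), (Rle_dec b r); unfold Rabs;
  repeat match goal with
  | |- context [Rle_dec ?x ?y] => destruct (Rle_dec x y)
  | |- context [Rcase_abs ?x] => destruct (Rcase_abs x)
  end; lra.
Qed.

(** Mean value theorem for the real part, with one-sided derivatives at the end
    points; precomposing with [clamp a b] turns these into the two-sided continuity
    that the classical theorem requires. *)
Lemma mean_value_within (u l : R -> C) (a b : R) :
  a < b ->
  (forall s, a <= s <= b -> deriv_within (fun r => a <= r <= b) u s (l s)) ->
  exists c, a <= c <= b /\ Re (u b) - Re (u a) = Re (l c) * (b - a).
Proof.
  intros Hab H.
  destruct (MVT_gen (fun s => Re (u (clamp a b s))) a b (fun s => Re (l s)))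
    as [c [Hc E]].
  - rewrite Rmin_left, Rmax_right by lra. intros x Hx.
    apply is_derive_Reals. intros eps He.
    assert (Hx' : a <= x <= b) by lra.
    destruct (H x Hx' (eps / 2)) as [d Hd]; [lra|].
    assert (Hd' : 0 < Rmin d (Rmin (x - a) (b - x))).
    { repeat apply Rmin_pos; try lra. apply cond_pos. }
    exists (mkposreal _ Hd'). intros h Hh Hhd. simpl in Hhd.
    assert (B1 : Rabs h < d) by (eapply Rlt_le_trans; [exact Hhd|apply Rmin_l]).
    assert (B2 : Rabs h < x - a).
    { eapply Rlt_le_trans; [exact Hhd|].
      eapply Rle_trans; [apply Rmin_r|apply Rmin_l]. }
    assert (B3 : Rabs h < b - x).
    { eapply Rlt_le_trans; [exact Hhd|].
      eapply Rle_trans; [apply Rmin_r|apply Rmin_r]. }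
    apply Rabs_def2 in B2; apply Rabs_def2 in B3.
    rewrite !clamp_id by lra.
    assert (K : Cmod (u (x + h)%R - u x - l x * RtoC h) <= eps / 2 * Rabs h).
    { assert (K := Hd (x + h)). cbv beta in K.
      replace (x + h - x) with h in K by ring. rewrite Cmod_R in K.
      apply K; [|lra].
      change (Rabs (x + h - x) < d). replace (x + h - x) with h by ring. exact B1. }
    apply (Rle_trans _ _ _ (re_le_Cmod _)) in K.
    rewrite !re_minus, re_scal_r in K.
    replace ((Re (u (x + h)%R) - Re (u x)) / h - Re (l x))
      with ((Re (u (x + h)%R) - Re (u x) - Re (l x) * h) / h) by (field; exact Hh).
    unfold Rdiv. rewrite Rabs_mult, Rabs_inv.
    assert (Hp : 0 < Rabs h) by (apply Rabs_pos_lt; exact Hh).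
    apply Rmult_lt_reg_r with (Rabs h); [exact Hp|].
    rewrite Rmult_assoc, Rinv_l by lra. nra.
  - rewrite Rmin_left, Rmax_right by lra. intros x Hx eps He.
    destruct (deriv_within_cont _ _ _ _ (H x Hx) eps He) as [d [Hd K]].
    exists d; split; [exact Hd|]. intros y [_ Hy].
    simpl in *. unfold Rdist in *.
    rewrite <- re_minus. eapply Rle_lt_trans; [apply re_le_Cmod|].
    rewrite (clamp_id a b x) by lra.
    apply K; [apply clamp_in; lra|].
    eapply Rle_lt_trans; [|exact Hy].
    rewrite <- (clamp_id a b x) at 1 by lra. apply clamp_lipschitz.
  - rewrite Rmin_left, Rmax_right in Hc by lra.
    exists c; split; [exact Hc|].
    rewrite !clamp_id in E by lra. exact E.
Qed.

Lemma mean_value_Im_within (u l : R -> C) (a b : R) :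
  a < b ->
  (forall s, a <= s <= b -> deriv_within (fun r => a <= r <= b) u s (l s)) ->
  exists c, a <= c <= b /\ Im (u b) - Im (u a) = Im (l c) * (b - a).
Proof.
  intros Hab H.
  assert (E : forall z, Re (- Ci * z)%C = Im z).
  { intros [x y]. simpl. ring. }
  destruct (mean_value_within (fun s => - Ci * u s)%C (fun s => - Ci * l s)%C a b Hab)
    as [c [Hc K]].
  - intros s Hs. apply deriv_along_scal; [typeclasses eauto|apply H, Hs].
  - exists c. rewrite !E in K. auto.
Qed.

(** The mean value theorem for the component of [u] in the direction of the
    increment. *)
Lemma mean_value_ineq_within (u l : R -> C) (a b M : R) :
  a < b ->
  (forall s, a <= s <= b -> deriv_within (fun r => a <= r <= b) u s (l s)) ->
  (forall s, a <= s <= b -> Cmod (l s) <= M) ->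
  Cmod (u b - u a) <= M * (b - a).
Proof.
  intros Hab H HM.
  set (D := (u b - u a)%C).
  destruct (Ceq_dec D (RtoC 0)) as [E|N].
  { rewrite E, Cmod_0. assert (K := HM a). assert (0 <= Cmod (l a)) by apply Cmod_ge_0.
    apply Rmult_le_pos; lra. }
  assert (Hm := proj1 (Cmod_gt_0 D) N).
  set (c := Cconj D).
  destruct (mean_value_within (fun s => c * u s)%C (fun s => c * l s)%C a b Hab)
    as [x [Hx E]].
  { intros s Hs. apply deriv_along_scal; [typeclasses eauto|apply H; exact Hs]. }
  rewrite <- re_minus in E.
  replace (c * u b - c * u a)%C with (c * D)%C in E by (unfold D; ring).
  assert (E1 : Re (c * D) = Cmod D * Cmod D).
  { replace (Cmod D * Cmod D) with (Cmod D ^ 2) by ring. rewrite Cmod2_alt.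
    unfold c. simpl. ring. }
  assert (E2 : Re (c * l x) <= Cmod D * M).
  { eapply Rle_trans; [apply Rle_abs|]. eapply Rle_trans; [apply re_le_Cmod|].
    rewrite Cmod_mult. unfold c. rewrite Cmod_conj.
    apply Rmult_le_compat_l; [lra|apply HM; exact Hx]. }
  rewrite E1 in E.
  apply Rmult_le_reg_l with (Cmod D); [exact Hm|]. rewrite E.
  rewrite <- Rmult_assoc. apply Rmult_le_compat_r; lra.
Qed.

Lemma constant_within (u : R -> C) (a b : R) :
  a < b ->
  (forall s, a <= s <= b -> deriv_within (fun r => a <= r <= b) u s (RtoC 0)) ->
  u b = u a.
Proof.
  intros Hab H.
  assert (K := mean_value_ineq_within u (fun _ => RtoC 0) a b 0 Hab H).
  apply Ceq_minus, Cmod_eq_0. apply Rle_antisym; [|apply Cmod_ge_0].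
  rewrite Rmult_0_l in K. apply K. intros s _. rewrite Cmod_0. lra.
Qed.

(** [s] is the supremum of the times up to which [f] stays below [c]. *)
Lemma first_exit (f : R -> R) (b c : R) :
  0 <= b ->
  (forall s, 0 <= s <= b -> forall eps, 0 < eps -> exists d, 0 < d /\
     forall r, 0 <= r <= b -> Rabs (r - s) < d -> Rabs (f r - f s) < eps) ->
  f 0 < c -> c <= f b ->
  exists s, 0 < s <= b /\ f s = c /\ forall r, 0 <= r < s -> f r < c.
Proof.
  intros Hb Hc H0 Hfb.
  set (E := fun s => 0 <= s <= b /\ forall r, 0 <= r <= s -> f r < c).
  assert (E0 : E 0).
  { split; [lra|]. intros r Hr. replace r with 0 by lra. exact H0. }
  destruct (completeness E) as [s [Hs1 Hs2]].
  { exists b. intros x [Hx _]; lra. }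
  { exists 0; exact E0. }
  assert (Hs0 : 0 <= s) by (apply Hs1, E0).
  assert (Hsb : s <= b) by (apply Hs2; intros x [Hx _]; lra).
  assert (Hlt : forall r, 0 <= r < s -> f r < c).
  { intros r Hr. apply NNPP. intros N.
    assert (s <= r); [|lra]. apply Hs2. intros x [Hx Kx].
    destruct (Rle_dec x r) as [|Q]; [assumption|]. exfalso; apply N, Kx; lra. }
  assert (Hfs : f s = c).
  { destruct (Rtotal_order (f s) c) as [L|[L|L]]; [exfalso|exact L|exfalso].
    - destruct (Hc s (conj Hs0 Hsb) (c - f s)) as [d [Hd K]]; [lra|].
      assert (Hs : s < b).
      { destruct (Rle_lt_or_eq_dec _ _ Hsb) as [|Q]; [assumption|].
        rewrite Q in L. lra. }
      set (s' := Rmin b (s + d / 2)).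
      assert (Hs' : s < s') by (apply Rmin_glb_lt; lra).
      assert (s'b : s' <= b) by apply Rmin_l.
      assert (s'd : s' <= s + d / 2) by apply Rmin_r.
      assert (E s'); [|assert (s' <= s) by (apply Hs1; assumption); lra].
      split; [lra|]. intros r Hr.
      destruct (Rlt_dec r s) as [Q|Q]; [apply Hlt; lra|].
      assert (Kr : Rabs (f r - f s) < c - f s).
      { apply K; [lra|]. rewrite Rabs_right by lra. lra. }
      apply Rabs_def2 in Kr. lra.
    - assert (Hs : 0 < s).
      { destruct (Rle_lt_or_eq_dec _ _ Hs0) as [|Q]; [assumption|].
        rewrite <- Q in L. lra. }
      destruct (Hc s (conj Hs0 Hsb) (f s - c)) as [d [Hd K]]; [lra|].
      set (r := Rmax 0 (s - d / 2)).
      assert (r0 : 0 <= r) by apply Rmax_l.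
      assert (rs : r < s) by (apply Rmax_lub_lt; lra).
      assert (rd : s - d / 2 <= r) by apply Rmax_r.
      assert (Kr : Rabs (f r - f s) < f s - c).
      { apply K; [lra|]. rewrite Rabs_left by lra. lra. }
      apply Rabs_def2 in Kr. assert (f r < c) by (apply Hlt; lra). lra. }
  exists s. split; [|split; assumption].
  split; [|exact Hsb].
  destruct (Rle_lt_or_eq_dec _ _ Hs0) as [|Q]; [assumption|].
  rewrite <- Q in Hfs. lra.
Qed.

(** * The logarithm on the half-plane *)

Lemma Clog_polar (r th : R) :
  0 < r -> 0 < th < PI -> Clog (r * cos th, r * sin th) = (ln r, th).
Proof.
  intros Hr Hth.
  assert (E : Cmod (r * cos th, r * sin th) = r).
  { unfold Cmod; simpl.
    replace (r * cos th * (r * cos th * 1) + r * sin th * (r * sin th * 1))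
      with (r * r * (Rsqr (sin th) + Rsqr (cos th))) by (unfold Rsqr; ring).
    rewrite sin2_cos2, Rmult_1_r. apply sqrt_square; lra. }
  unfold Clog. rewrite E. simpl.
  replace (r * cos th / r) with (cos th) by (field; lra).
  rewrite acos_cos by lra. reflexivity.
Qed.

Lemma Cmod_upper (w : C) : upper_half_plane w -> 0 < Cmod w.
Proof.
  intros H. eapply Rlt_le_trans; [exact H|].
  eapply Rle_trans; [apply Rle_abs|apply im_le_Cmod].
Qed.

Lemma upper_neq_0 (w : C) : upper_half_plane w -> w <> RtoC 0.
Proof. intros H. apply Cmod_gt_0, Cmod_upper, H. Qed.

Lemma polar_atan (x y : R) :
  0 < y ->
  0 < sqrt (x ^ 2 + y ^ 2) /\ 0 < PI / 2 - atan (x / y) < PI /\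
  x = sqrt (x ^ 2 + y ^ 2) * cos (PI / 2 - atan (x / y)) /\
  y = sqrt (x ^ 2 + y ^ 2) * sin (PI / 2 - atan (x / y)).
Proof.
  intros Hy.
  assert (Ha := atan_bound (x / y)).
  set (r := sqrt (x ^ 2 + y ^ 2)).
  assert (Hr : 0 < r) by (apply sqrt_lt_R0; nra).
  assert (Hq : sqrt (1 + (x / y)²) = r / y).
  { replace (1 + (x / y)²) with ((x ^ 2 + y ^ 2) / (y * y)) by (unfold Rsqr; field; lra).
    rewrite sqrt_div by nra. rewrite sqrt_square by lra. reflexivity. }
  rewrite cos_shift, sin_shift, sin_atan, cos_atan, Hq.
  repeat split; try lra; field; lra.
Qed.

Lemma Clog_atan (x y : R) :
  0 < y -> Clog (x, y) = (ln (sqrt (x ^ 2 + y ^ 2)), PI / 2 - atan (x / y)).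
Proof.
  intros Hy. destruct (polar_atan x y Hy) as [Hr [Ha [Ex Ey]]].
  rewrite Ex at 1. rewrite Ey at 3. apply Clog_polar; assumption.
Qed.

Lemma Clog_upper (w : C) :
  upper_half_plane w ->
  0 < Im (Clog w) < PI /\
  w = (exp (Re (Clog w)) * cos (Im (Clog w)), exp (Re (Clog w)) * sin (Im (Clog w))).
Proof.
  destruct w as [x y]. intros H. unfold upper_half_plane in H; simpl in H.
  destruct (polar_atan x y H) as [Hr [Ha [Ex Ey]]].
  rewrite Clog_atan by exact H. cbn [Re Im fst snd].
  rewrite exp_ln by exact Hr. split; [exact Ha|]. rewrite <- Ex, <- Ey. reflexivity.
Qed.

Lemma deriv_within_pair (D : R -> Prop) (f g : R -> R) (t l m : R) :
  is_derive f t l -> is_derive g t m ->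
  deriv_within D (fun s => (f s, g s) : C) t (l, m).
Proof.
  intros Hf Hg.
  assert (H := deriv_along_plus _ _ _ _ _ _ _ _ (is_derive_deriv_within D _ _ _ Hf)
    (deriv_along_scal _ _ _ _ _ Ci (is_derive_deriv_within D _ _ _ Hg))).
  assert (E : forall a b, (RtoC a + Ci * RtoC b)%C = (a, b)).
  { intros a b. unfold RtoC, Ci, Cplus, Cmult; simpl. f_equal; ring. }
  unfold deriv_within. rewrite <- (E l m), <- (E (f t) (g t)). revert H.
  apply deriv_along_ext; auto; try typeclasses eauto.
  apply filter_forall. intros s. apply E.
Qed.

Lemma Clog_line (D : R -> Prop) (w h : C) (s : R) :
  upper_half_plane (w + s * h)%C ->
  deriv_within D (fun r => Clog (w + r * h))%C s (h / (w + s * h))%C.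
Proof.
  intros H.
  destruct w as [x y], h as [a b].
  assert (E : forall r, ((x, y) + RtoC r * (a, b))%C = (x + r * a, y + r * b)).
  { intros r. unfold RtoC, Cplus, Cmult; simpl. f_equal; ring. }
  rewrite E in *. unfold upper_half_plane in H; simpl in H.
  set (N := (x + s * a) ^ 2 + (y + s * b) ^ 2).
  assert (HN : 0 < N) 
    by (apply Rplus_le_lt_0_compat; [apply pow2_ge_0|apply pow_lt; exact H]).
  assert (HsN : 0 < sqrt N) by (apply sqrt_lt_R0; exact HN).
  assert (HsN2 : sqrt N * sqrt N = N) by (apply sqrt_sqrt; lra).
  assert (D1 : is_derive (fun r => ln (sqrt ((x + r * a) ^ 2 + (y + r * b) ^ 2))) s
                 ((a * (x + s * a) + b * (y + s * b)) / N)).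
  { auto_derive.
    - change (0 < N /\ 0 < sqrt N /\ True). auto.
    - change (sqrt ((x + s * a) * ((x + s * a) * 1) + (y + s * b) * ((y + s * b) * 1)))
        with (sqrt N).
      replace (_ / N) with ((a * (x + s * a) + b * (y + s * b)) / (sqrt N * sqrt N))
        by (rewrite HsN2; reflexivity).
      generalize HsN. generalize (sqrt N). intros q Hq. field. lra. }
  assert (D2 : is_derive (fun r => PI / 2 - atan ((x + r * a) / (y + r * b))) s
                 ((b * (x + s * a) - a * (y + s * b)) / N)).
  { auto_derive; [lra|]. unfold N, Rsqr. field. unfold N in HN.
    split; [|lra]. intros Q. apply (Rlt_not_eq _ _ HN). rewrite <- Q. ring. }
  assert (K := deriv_within_pair D _ _ _ _ _ D1 D2).
  revert K. unfold deriv_within. cbv beta. rewrite E, <- Clog_atan by exact H.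
  apply deriv_along_ext.
  - typeclasses eauto.
  - apply filter_le_within.
    assert (Hc : continuous (fun r => y + r * b) s).
    { apply (ex_derive_continuous (fun r => y + r * b)). auto_derive. exact I. }
    assert (Hp : locally s (fun r => 0 < y + r * b))
      by exact (Hc (fun v => 0 < v) (open_gt 0 _ H)).
    revert Hp. apply filter_imp.
    intros r Hr. rewrite E. symmetry. apply Clog_atan. exact Hr.
  - unfold Cdiv, Cinv, Cmult; simpl. fold N.
    replace ((x + s * a) * ((x + s * a) * 1) + (y + s * b) * ((y + s * b) * 1))
      with N by (unfold N; ring).
    f_equal; field; lra.
Qed.

Lemma Im_line (w h : C) (s : R) : Im (w + s * h)%C = Im w + s * Im h.
Proof. rewrite im_plus, im_scal_l. reflexivity. Qed.

(** Along a segment the increment of [Clog] differs from its linear part by the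
    integral of [h / (w + s h) - h / w], which is quadratic in [h]. *)
Lemma complex_deriv_Clog (w : C) :
  upper_half_plane w -> complex_deriv Clog w (/ w)%C.
Proof.
  intros Hw eps He.
  assert (Hm := Cmod_upper w Hw). assert (Hw0 := upper_neq_0 w Hw).
  unfold upper_half_plane in Hw.
  set (R0 := Cmod w) in *.
  assert (HI : Im w <= R0) by (eapply Rle_trans; [apply Rle_abs|apply im_le_Cmod]).
  set (d := Rmin (Im w / 2) (eps * (R0 * R0) / 2)).
  assert (Hd : 0 < d).
  { apply Rmin_pos; [lra|]. apply Rdiv_lt_0_compat; [|lra].
    repeat apply Rmult_lt_0_compat; lra. }
  apply locally_Cmod. exists d; split; [exact Hd|]. intros v Hv.
  assert (d1 : d <= Im w / 2) by apply Rmin_l.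
  assert (d2 : d <= eps * (R0 * R0) / 2) by apply Rmin_r.
  set (h := (v - w)%C) in *.
  assert (Hh := Cmod_ge_0 h).
  assert (Hseg : forall s, 0 <= s <= 1 ->
            upper_half_plane (w + s * h)%C /\ R0 / 2 <= Cmod (w + s * h)%C
            /\ Cmod (RtoC s * h)%C <= Cmod h).
  { intros s Hs. unfold upper_half_plane. rewrite Im_line.
    assert (Hi := im_le_Cmod h). apply Rabs_le_between in Hi.
    assert (HC : Cmod (RtoC s * h)%C <= Cmod h).
    { rewrite Cmod_mult, Cmod_R, Rabs_right by lra. nra. }
    split; [nra|]. split; [|exact HC].
    assert (T := Cmod_sub_ge w (- (RtoC s * h))%C). rewrite Cmod_opp in T.
    replace (w - - (RtoC s * h))%C with (w + RtoC s * h)%C in T by ring.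
    fold R0 in T. lra. }
  assert (M := mean_value_ineq_within
    (fun s => Clog (w + s * h) - (h / w) * RtoC s)%C
    (fun s => h / (w + s * h) - (h / w) * RtoC 1)%C 0 1
    (2 * Cmod h / (R0 * R0) * Cmod h) Rlt_0_1).
  cbv beta in M.
  replace (w + RtoC 1 * h)%C with v in M by (unfold h; ring).
  replace (w + RtoC 0 * h)%C with w in M by ring.
  replace (Clog v - h / w * RtoC 1 - (Clog w - h / w * RtoC 0))%C
    with (Clog v - Clog w - / w * h)%C in M by (field; exact Hw0).
  rewrite Rminus_0_r, Rmult_1_r in M.
  eapply Rle_trans; [apply M|].
  - intros s Hs. destruct (Hseg s Hs) as [Hu _].
    apply deriv_along_minus; [typeclasses eauto|apply Clog_line; exact Hu|].
    apply deriv_along_scal; [typeclasses eauto|].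
    apply deriv_within_var.
  - intros s Hs. destruct (Hseg s Hs) as [Hu [Hl Hc]].
    assert (Hn := upper_neq_0 _ Hu).
    replace (h / (w + s * h) - h / w * RtoC 1)%C
      with (- ((RtoC s * h) / (w * (w + s * h)) * h))%C by (field; split; assumption).
    rewrite Cmod_opp, Cmod_mult. apply Rmult_le_compat_r; [exact Hh|].
    rewrite Cmod_div by (apply Cmult_neq_0; assumption).
    rewrite (Cmod_mult w). fold R0.
    replace (2 * Cmod h / (R0 * R0)) with (Cmod h / (R0 * (R0 / 2))) by (field; lra).
    unfold Rdiv. apply Rmult_le_compat; try apply Cmod_ge_0; try exact Hc.
    + apply Rlt_le, Rinv_0_lt_compat. apply Rmult_lt_0_compat; lra.
    + apply Rinv_le_contravar; [apply Rmult_lt_0_compat; lra|].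
      apply Rmult_le_compat_l; lra.
  - apply Rmult_le_compat_r; [exact Hh|].
    assert (HR2 : 0 < R0 * R0) by (apply Rmult_lt_0_compat; lra).
    apply Rmult_le_reg_r with (R0 * R0); [exact HR2|].
    unfold Rdiv. rewrite Rmult_assoc, Rinv_l by lra. lra.
Qed.

(** * Injectivity from the sign of the derivative *)

(** Quantitative form of the Noshiro-Warschawski criterion: a derivative with
    values in a half-plane separates the end points of a segment, and the
    part of the segment near one end point already gives a lower bound. *)
Lemma noshiro_segment (f f' : C -> C) (a h : C) (c sigma : R) :
  0 <= c -> 0 < sigma <= 1 ->
  (forall s, 0 <= s <= 1 -> complex_deriv f (a + RtoC s * h)%C (f' (a + RtoC s * h)%C)) ->
  (forall s, 0 <= s <= 1 -> Im (f' (a + RtoC s * h)%C) <= 0) ->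
  (forall s, 0 <= s <= sigma -> Im (f' (a + RtoC s * h)%C) <= - c) ->
  c * sigma * Cmod h <= Cmod (f (a + h)%C - f a).
Proof.
  intros Hc Hs Hf H0 H1.
  destruct (Ceq_dec h (RtoC 0)) as [E|N].
  { rewrite E, Cmod_0, Rmult_0_r. apply Cmod_ge_0. }
  assert (Hh := proj1 (Cmod_gt_0 h) N).
  (* [q] times the velocity [f' * h] has real part [- |h|^2 Im f']. *)
  set (q := (Ci * Cconj h)%C).
  set (u := fun s : R => (q * f (a + RtoC s * h))%C).
  set (l := fun s : R => (q * (f' (a + RtoC s * h) * h))%C).
  assert (Hd : forall D s, 0 <= s <= 1 -> deriv_within D u s (l s)).
  { intros D s Hs'. apply deriv_along_scal; [typeclasses eauto|].
    assert (K : deriv_along (within D (locally s)) (fun r => RtoC (r - s))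
                  (fun r => a + RtoC r * h)%C (a + RtoC s * h)%C h).
    { assert (L := deriv_along_plus _ _ _ _ _ _ _ _
        (deriv_along_const _ _ a)
        (deriv_along_scal _ _ _ _ _ h
(deriv_within_var D s))).
      revert L. replace (a + h * RtoC s)%C with (a + RtoC s * h)%C by ring.
      apply deriv_along_ext; [typeclasses eauto| |].
      - apply filter_forall. intros r. ring.
      - ring. }
    apply (deriv_along_comp _ _ _ f _ _ _ (vanishing_within D s) (Hf s Hs') K). }
  assert (Hl : forall s, Re (l s) = - (Cmod h * Cmod h) * Im (f' (a + RtoC s * h)%C)).
  { intros s. unfold l, q. set (F := f' _).
    replace (Cmod h * Cmod h) with (Cmod h ^ 2) by ring. rewrite Cmod2_alt.
    destruct h as [h1 h2], F as [F1 F2]. simpl. ring. }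
  assert (P2 : 0 < Cmod h * Cmod h) by (apply Rmult_lt_0_compat; exact Hh).
  destruct (mean_value_within u l 0 sigma) as [x [Hx Ex]]; [lra| |].
  { intros s Hs'. apply Hd; lra. }
  assert (B1 : Cmod h * Cmod h * c * sigma <= Re (u sigma) - Re (u 0)).
  { rewrite Ex, Hl, Rminus_0_r. apply Rmult_le_compat_r; [lra|].
    assert (K := H1 x Hx). nra. }
  assert (B2 : 0 <= Re (u 1) - Re (u sigma)).
  { destruct (Req_dec sigma 1) as [->|N1]; [lra|].
    destruct (mean_value_within u l sigma 1) as [y [Hy Ey]]; [lra| |].
    { intros s Hs'. apply Hd; lra. }
    rewrite Ey, Hl. apply Rmult_le_pos; [|lra].
    assert (K := H0 y ltac:(lra)). nra. }
  assert (B3 : Re (u 1) - Re (u 0) <= Cmod h * Cmod (f (a + h)%C - f a)).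
  { rewrite <- re_minus. eapply Rle_trans; [apply Rle_abs|].
    eapply Rle_trans; [apply re_le_Cmod|]. unfold u.
    replace (a + RtoC 1 * h)%C with (a + h)%C by ring.
    replace (a + RtoC 0 * h)%C with a by ring.
    replace (q * f (a + h) - q * f a)%C with (q * (f (a + h) - f a))%C by ring.
    unfold q. rewrite !Cmod_mult, Cmod_Ci, Cmod_conj. lra. }
  apply Rmult_le_reg_l with (Cmod h); [exact Hh|]. lra.
Qed.

(** [k] in the coordinate [mob z]. *)
Definition Kw (w : C) : C := (1 + w + Clog w)%C.

Definition mob (z : C) : C := (2 / (2 - z))%C.

Definition unmob (w : C) : C := (2 - 2 / w)%C.

Lemma sub_2_neq_0 (z : C) : upper_half_plane z -> (2 - z)%C <> RtoC 0.
Proof.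
  intros H E. apply (f_equal Im) in E. rewrite im_minus, !im_RtoC in E.
  unfold upper_half_plane in H. lra.
Qed.

Lemma RtoC_neq_0 (x : R) : x <> 0 -> RtoC x <> RtoC 0.
Proof. intros H E. apply H, RtoC_inj, E. Qed.

Lemma upper_inv (w : C) : upper_half_plane w -> upper_half_plane (- / w)%C.
Proof.
  destruct w as [x y]. unfold upper_half_plane. simpl. intros H.
  replace (- (- y / (x * (x * 1) + y * (y * 1)))) with (y / (x ^ 2 + y ^ 2))
    by (field; nra).
  apply Rdiv_lt_0_compat; nra.
Qed.

Lemma upper_scal (c : R) (w : C) :
  0 < c -> upper_half_plane w -> upper_half_plane (RtoC c * w)%C.
Proof.
  unfold upper_half_plane. intros H K. rewrite im_scal_l.
  apply Rmult_lt_0_compat; assumption.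
Qed.

Lemma mob_upper (z : C) : upper_half_plane z -> upper_half_plane (mob z).
Proof.
  intros H. assert (N := sub_2_neq_0 z H).
  replace (mob z) with (RtoC 2 * - / (z - 2))%C.
  - apply upper_scal; [lra|]. apply upper_inv.
    unfold upper_half_plane in *. rewrite im_minus, im_RtoC. lra.
  - unfold mob. field. split; [exact N|].
    intros E. apply N. replace (2 - z)%C with (- (z - 2))%C by ring. rewrite E. ring.
Qed.

Lemma unmob_upper (w : C) : upper_half_plane w -> upper_half_plane (unmob w).
Proof.
  intros H. assert (K := upper_scal 2 _ ltac:(lra) (upper_inv w H)).
  unfold upper_half_plane in *.
  replace (unmob w) with (2 + RtoC 2 * - / w)%C
    by (unfold unmob; field; apply upper_neq_0, H).
  rewrite im_plus, im_RtoC. lra.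
Qed.

Lemma mob_unmob (w : C) : upper_half_plane w -> mob (unmob w) = w.
Proof.
  intros H. unfold mob, unmob.
  assert (N := upper_neq_0 w H). assert (N2 := RtoC_neq_0 2 ltac:(lra)).
  field. split; [exact N|].
  replace (2 * w - (2 * w - 2))%C with (RtoC 2) by ring. exact N2.
Qed.

Lemma unmob_mob (z : C) : upper_half_plane z -> unmob (mob z) = z.
Proof.
  intros H. unfold mob, unmob.
  assert (N := sub_2_neq_0 z H).
  field. exact N.
Qed.

Lemma k_mob (z : C) : upper_half_plane z -> k z = Kw (mob z).
Proof.
  intros H. unfold k, Kw. fold (mob z). f_equal.
  unfold mob. field. apply sub_2_neq_0, H.
Qed.

Lemma complex_deriv_Kw (w : C) :
  upper_half_plane w -> complex_deriv Kw w (1 + / w)%C.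
Proof.
  intros H.
  assert (Hid : forall x : C, x = (w + (x - w))%C) by (intros x; ring).
  assert (L := deriv_along_plus _ _ _ _ _ _ _ _
    (deriv_along_plus _ _ _ _ _ _ _ _ (deriv_along_const _ _ (RtoC 1))
      (deriv_along_id (locally w) (fun x => x - w)%C (fun x => x) w Hid))
    (complex_deriv_Clog w H)).
  unfold complex_deriv. revert L. apply deriv_along_ext; [typeclasses eauto| |ring].
  apply filter_forall. reflexivity.
Qed.

Lemma Kw_deriv_neq_0 (w : C) : upper_half_plane w -> (1 + / w)%C <> RtoC 0.
Proof.
  intros H E. assert (K := upper_inv w H). apply (f_equal Im) in E.
  unfold upper_half_plane in K. rewrite im_opp in K.
  rewrite im_plus, !im_RtoC in E. lra.
Qed.

Lemma Im_Kw_deriv (w : C) : Im (1 + / w)%C = - (Im w / Cmod w ^ 2).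
Proof.
  rewrite im_plus, im_RtoC, Cmod2_alt. destruct w as [x y]. simpl. unfold Rdiv. ring.
Qed.

Lemma upper_segment (w v : C) (s : R) :
  upper_half_plane w -> upper_half_plane v -> 0 <= s <= 1 ->
  upper_half_plane (w + RtoC s * (v - w))%C.
Proof.
  unfold upper_half_plane. intros Hw Hv Hs. rewrite Im_line, im_minus.
  destruct (Rle_lt_dec s (1 / 2)); nra.
Qed.

(** The bound is by a minimum because [v] may be far away: only the part of the
    segment near [w] is controlled from below, and it already suffices. *)
Lemma Kw_separates (w : C) :
  upper_half_plane w ->
  exists c d, 0 < c /\ 0 < d /\ forall v, upper_half_plane v ->
    c * Rmin (Cmod (v - w)) d <= Cmod (Kw v - Kw w).
Proof.
  intros Hw. assert (Hm := Cmod_upper w Hw).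
  assert (HI : Im w <= Cmod w) by (eapply Rle_trans; [apply Rle_abs|apply im_le_Cmod]).
  set (y := Im w). assert (Hy : 0 < y) by exact Hw. fold y in HI.
  set (c := y / 2 / (2 * Cmod w) ^ 2).
  assert (Hc : 0 < c) by (apply Rdiv_lt_0_compat; [lra|apply pow_lt; lra]).
  exists c, (y / 2). split; [exact Hc|]. split; [lra|]. intros v Hv.
  destruct (Ceq_dec v w) as [->|N].
  { replace (w - w)%C with (RtoC 0) by ring. rewrite Cmod_0, Rmin_left by lra.
    rewrite Rmult_0_r. apply Cmod_ge_0. }
  set (h := (v - w)%C).
  assert (Hh : 0 < Cmod h) by (apply Cmod_gt_0, Cminus_eq_contra, N).
  set (sigma := Rmin (Cmod h) (y / 2) / Cmod h).
  assert (Hmin : 0 < Rmin (Cmod h) (y / 2)) by (apply Rmin_pos; lra).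
  assert (Hs : 0 < sigma <= 1).
  { split; [apply Rdiv_lt_0_compat; assumption|].
    apply Rmult_le_reg_r with (Cmod h); [exact Hh|]. unfold sigma, Rdiv.
    rewrite Rmult_assoc, Rinv_l by lra. assert (K := Rmin_l (Cmod h) (y / 2)). lra. }
  assert (Es : sigma * Cmod h = Rmin (Cmod h) (y / 2)) by (unfold sigma; field; lra).
  assert (B := noshiro_segment Kw (fun x => 1 + / x)%C w h c sigma ltac:(lra) Hs).
  rewrite Rmult_assoc, Es in B.
  replace (w + h)%C with v in B by (unfold h; ring). apply B.
  - intros s Hs'. apply complex_deriv_Kw, upper_segment; assumption.
  - intros s Hs'. rewrite Im_Kw_deriv.
    assert (K := upper_segment w v s Hw Hv Hs'). fold h in K.
    assert (K2 := Cmod_upper _ K).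
    assert (0 < Im (w + RtoC s * h)%C / Cmod (w + RtoC s * h)%C ^ 2); [|lra].
    apply Rdiv_lt_0_compat; [exact K|apply pow_lt; exact K2].
  - intros s Hs'. rewrite Im_Kw_deriv.
    assert (K := upper_segment w v s Hw Hv ltac:(lra)). fold h in K.
    assert (K2 := Cmod_upper _ K).
    assert (D : Cmod (RtoC s * h)%C <= y / 2).
    { rewrite Cmod_mult, Cmod_R, Rabs_right by lra.
      apply Rle_trans with (sigma * Cmod h); [apply Rmult_le_compat_r; lra|].
      rewrite Es. apply Rmin_r. }
    assert (D1 : y / 2 <= Im (w + RtoC s * h)%C).
    { rewrite im_plus. fold y. assert (J := im_le_Cmod (RtoC s * h)%C).
      apply Rabs_le_between in J. lra. }
    assert (D2 : Cmod (w + RtoC s * h)%C <= 2 * Cmod w).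
    { eapply Rle_trans; [apply Cmod_triangle|]. lra. }
    apply Ropp_le_contravar. unfold c, Rdiv at 1 3.
    apply Rmult_le_compat; [lra| |exact D1|].
    + apply Rlt_le, Rinv_0_lt_compat, pow_lt; lra.
    + apply Rinv_le_contravar; [apply pow_lt; exact K2|].
      apply pow_incr. lra.
Qed.

Lemma Kw_inj (w v : C) :
  upper_half_plane w -> upper_half_plane v -> Kw v = Kw w -> v = w.
Proof.
  intros Hw Hv E. destruct (Kw_separates w Hw) as [c [d [Hc [Hd K]]]].
  specialize (K v Hv). rewrite E in K.
  replace (Kw w - Kw w)%C with (RtoC 0) in K by ring. rewrite Cmod_0 in K.
  apply Ceq_minus, Cmod_eq_0. apply Rle_antisym; [|apply Cmod_ge_0].
  unfold Rmin in K. destruct (Rle_dec _ _); nra.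
Qed.

(** * The image of [Kw] *)

Lemma x_cos_le_sin (x : R) : 0 < x <= PI -> x * cos x <= sin x.
Proof.
  intros Hx.
  destruct (MVT_cor2 sin cos 0 x) as [c [E Hc]]; [lra| |].
  { intros c Hc. apply derivable_pt_lim_sin. }
  rewrite sin_0 in E. replace (sin x) with (cos c * x) by lra.
  rewrite Rmult_comm. apply Rmult_le_compat_r; [lra|].
  apply cos_decr_1; lra.
Qed.

(** On the preimage under [Kw] of the line [Im = PI], the point of imaginary part
    [th] is [- th cot th + i th], and this is the real part of its image. *)
Definition ray_height (th : R) : R := 1 + ln (th / sin th) - th * cos th / sin th.

Lemma ray_height_pos (th : R) : 0 < th < PI -> 0 < ray_height th.
Proof.
  intros Hth. assert (Hs : 0 < sin th) by (apply sin_gt_0; lra).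
  assert (Hl : 0 < ln (th / sin th)).
  { rewrite <- ln_1. apply ln_increasing; [lra|].
    apply Rmult_lt_reg_r with (sin th); [exact Hs|]. unfold Rdiv.
    rewrite Rmult_assoc, Rinv_l by lra. assert (K := sin_lt_x th). lra. }
  assert (Hc : th * cos th / sin th <= 1).
  { apply Rmult_le_reg_r with (sin th); [exact Hs|]. unfold Rdiv.
    rewrite Rmult_assoc, Rinv_l by lra. assert (K := x_cos_le_sin th). lra. }
  unfold ray_height. lra.
Qed.

(** The derivative is the sum of two squares over [th sin^2 th]. *)
Lemma ray_height_increasing (a b : R) :
  0 < a -> a < b -> b < PI -> ray_height a < ray_height b.
Proof.
  intros Ha Hab Hb.
  destruct (MVT_cor2 ray_height
    (fun th => ((th - sin th * cos th) ^ 2 + (sin th ^ 2) ^ 2) / (th * sin th ^ 2))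
    a b Hab) as [c [E Hc]].
  - intros c Hc. assert (Hs : 0 < sin c) by (apply sin_gt_0; lra).
    apply is_derive_Reals. unfold ray_height. auto_derive.
    + repeat split; try lra. apply Rdiv_lt_0_compat; lra.
    + field_simplify_eq; [|repeat split; try lra].
      assert (P : cos c * cos c = 1 - sin c * sin c).
      { assert (Q := sin2_cos2 c). unfold Rsqr in Q. lra. }
      replace (cos c ^ 2) with (1 - sin c * sin c) by (rewrite <- P; ring). ring.
  - assert (Hs : 0 < sin c) by (apply sin_gt_0; lra).
    assert (0 < ((c - sin c * cos c) ^ 2 + (sin c ^ 2) ^ 2) / (c * sin c ^ 2)).
    { apply Rdiv_lt_0_compat.
      - apply Rplus_le_lt_0_compat; [apply pow2_ge_0|repeat apply pow_lt; exact Hs].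
      - apply Rmult_lt_0_compat; [lra|apply pow_lt; exact Hs]. }
    nra.
Qed.

Lemma slit_intro (u v : R) :
  0 < v -> (v = PI -> 0 < u) -> slit_half_plane (u, v).
Proof.
  intros Hv Hu. split; [exact Hv|]. intros [x [Hx E]].
  apply (f_equal Im) in E as E2. apply (f_equal Re) in E.
  unfold RtoC, Ci, Cplus, Cmult in E, E2. simpl in E, E2.
  assert (0 < u) by (apply Hu; lra). lra.
Qed.

Lemma slit_elim (w : C) :
  slit_half_plane w -> 0 < Im w /\ (Im w = PI -> 0 < Re w).
Proof.
  intros [H N]. split; [exact H|]. intros E. apply Rnot_le_lt. intros L. apply N.
  exists (Re w). split; [exact L|]. destruct w as [x y]. simpl in *.
  unfold RtoC, Ci, Cplus, Cmult; simpl. f_equal; lra.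
Qed.

Lemma slit_iff (w : C) :
  slit_half_plane w <-> 0 < Im w /\ (Im w = PI -> 0 < Re w).
Proof.
  split; [apply slit_elim|]. intros [H1 H2]. destruct w as [u v].
  apply slit_intro; assumption.
Qed.

Lemma Kw_ray (w : C) :
  upper_half_plane w -> Im (Kw w) = PI ->
  0 < Im w < PI /\ Re (Kw w) = ray_height (Im w) /\
  w = (- (Im w * cos (Im w) / sin (Im w)), Im w).
Proof.
  intros Hw E.
  destruct (Clog_upper w Hw) as [Ha Ew].
  unfold Kw in *. rewrite !im_plus, im_RtoC in E. rewrite !re_plus, re_RtoC.
  set (r := Re (Clog w)) in *. set (a := Im (Clog w)) in *.
  assert (E1 : Re w = exp r * cos a) by (rewrite Ew at 1; reflexivity).
  assert (E2 : Im w = exp r * sin a) by (rewrite Ew at 1; reflexivity).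
  assert (Hy : 0 < Im w) by exact Hw.
  set (th := Im w) in *.
  assert (Ht : a = PI - th) by lra.
  assert (S : sin a = sin th) by (rewrite Ht; apply sin_PI_x).
  assert (C' : cos a = - cos th) by (rewrite Ht; apply Rtrigo_facts.cos_pi_minus).
  assert (Hs : 0 < sin th) by (apply sin_gt_0; lra).
  assert (Er : exp r = th / sin th) by (rewrite S in E2; apply Rmult_eq_reg_r with (sin th); [rewrite <- E2; field|]; lra).
  assert (Er' : r = ln (th / sin th)) by (rewrite <- Er, ln_exp; reflexivity).
  rewrite C', Er in E1.
  split; [lra|]. split.
  - unfold ray_height. rewrite <- Er', E1. field. lra.
  - assert (E3 : w = (Re w, Im w)) by (destruct w; reflexivity).
    rewrite E3 at 1. rewrite E1. f_equal. field. lra.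
Qed.

Lemma Kw_slit (w : C) : upper_half_plane w -> slit_half_plane (Kw w).
Proof.
  intros Hw. apply slit_iff. split.
  - destruct (Clog_upper w Hw) as [Ha _].
    unfold Kw. rewrite !im_plus, im_RtoC. unfold upper_half_plane in Hw. lra.
  - intros E. destruct (Kw_ray w Hw E) as [Ht [-> _]]. apply ray_height_pos, Ht.
Qed.

(** Real part of [Kw] at the point of argument [y] on the preimage of the line
    [Im = v]: there the modulus is [(v - y) / sin y]. *)
Definition level_height (v y : R) : R :=
  1 + ln ((v - y) / sin y) + (v - y) / sin y * cos y.

Lemma Kw_level (v y : R) :
  0 < y < PI -> y < v ->
  exists w, upper_half_plane w /\ Kw w = (level_height v y, v).
Proof.
  intros Hy Hv.
  assert (Hs : 0 < sin y) by (apply sin_gt_0; lra).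
  set (r := (v - y) / sin y).
  assert (Hr : 0 < r) by (apply Rdiv_lt_0_compat; lra).
  exists (r * cos y, r * sin y). split.
  - unfold upper_half_plane. simpl. apply Rmult_lt_0_compat; assumption.
  - unfold Kw. rewrite Clog_polar by assumption.
    unfold level_height. fold r. unfold RtoC, Cplus. simpl.
    f_equal; [ring|]. unfold r. field. lra.
Qed.

(** As [y] tends to [0] the modulus tends to infinity. *)
Lemma level_height_large (v u m : R) :
  0 < v -> 0 < m -> exists y, 0 < y < m /\ y < v /\ y < PI /\ u < level_height v y.
Proof.
  intros Hv Hm.
  assert (P := PI2_3_2). assert (Ex := exp_pos (- u)).
  set (q := Rmin (Rmin m 1) (Rmin (v / 2) (v / 2 * exp (- u)))).
  assert (Hq : 0 < q).
  { repeat apply Rmin_pos; try lra. apply Rmult_lt_0_compat; lra. }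
  assert (q1 : q <= m) by (eapply Rle_trans; [apply Rmin_l|apply Rmin_l]).
  assert (q2 : q <= 1) by (eapply Rle_trans; [apply Rmin_l|apply Rmin_r]).
  assert (q3 : q <= v / 2) by (eapply Rle_trans; [apply Rmin_r|apply Rmin_l]).
  assert (q4 : q <= v / 2 * exp (- u)) by (eapply Rle_trans; [apply Rmin_r|apply Rmin_r]).
  exists (q / 2). set (y := q / 2). assert (Hy : 0 < y < q) by (unfold y; lra).
  repeat split; try lra.
  assert (Hs : 0 < sin y) by (apply sin_gt_0; lra).
  assert (Hc : 0 < cos y) by (apply cos_gt_0; lra).
  assert (Hsy := sin_lt_x y ltac:(lra)).
  assert (HA : exp u < (v - y) / sin y).
  { apply Rmult_lt_reg_r with (sin y); [exact Hs|]. unfold Rdiv.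
    rewrite Rmult_assoc, Rinv_l, Rmult_1_r by lra.
    assert (Eu := exp_pos u).
    assert (E1 : exp u * exp (- u) = 1) by (rewrite <- exp_plus, Rplus_opp_r; apply exp_0).
    assert (exp u * sin y < exp u * (v / 2 * exp (- u))).
    { apply Rmult_lt_compat_l; lra. }
    replace (exp u * (v / 2 * exp (- u))) with (v / 2 * (exp u * exp (- u))) in H by ring.
    rewrite E1 in H. lra. }
  assert (HA0 : 0 < (v - y) / sin y) by (assert (K := exp_pos u); lra).
  assert (L : u < ln ((v - y) / sin y)).
  { rewrite <- (ln_exp u) at 1. apply ln_increasing; [apply exp_pos|exact HA]. }
  assert (0 < (v - y) / sin y * cos y) by (apply Rmult_lt_0_compat; assumption).
  unfold level_height. lra.
Qed.

Lemma ln_le_sub_1 (x : R) : 0 < x -> ln x <= x - 1.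
Proof.
  intros H. assert (K := exp_ineq1_le (ln x)). rewrite exp_ln in K by exact H. lra.
Qed.

Lemma cos_ge_half (x : R) : 0 <= x <= 1 -> 1 / 2 <= cos x.
Proof.
  intros H. assert (P := PI2_3_2). rewrite <- cos_PI3.
  apply cos_decr_1; lra.
Qed.

(** As [y] tends to [v] the modulus tends to [0], and the logarithm wins. *)
Lemma level_height_small_lt_PI (v u : R) :
  0 < v -> v < PI -> exists y, 0 < y < v /\ level_height v y < u.
Proof.
  intros Hv HP.
  assert (S1 : 0 < sin (v / 2)) by (apply sin_gt_0; lra).
  assert (S2 : 0 < sin v) by (apply sin_gt_0; lra).
  set (s0 := Rmin (sin (v / 2)) (sin v)).
  assert (Hs0 : 0 < s0) by (apply Rmin_pos; assumption).
  assert (s1 : s0 <= sin (v / 2)) by apply Rmin_l.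
  assert (s2 : s0 <= sin v) by apply Rmin_r.
  assert (Eu := exp_pos (u - 3)).
  set (d := Rmin (v / 2) (s0 * Rmin 1 (exp (u - 3)))).
  assert (Hm : 0 < Rmin 1 (exp (u - 3))) by (apply Rmin_pos; lra).
  assert (Hd : 0 < d).
  { apply Rmin_pos; [lra|]. apply Rmult_lt_0_compat; assumption. }
  assert (d1 : d <= v / 2) by apply Rmin_l.
  assert (d2 : d <= s0 * Rmin 1 (exp (u - 3))) by apply Rmin_r.
  exists (v - d). split; [lra|].
  assert (Hs : s0 <= sin (v - d)).
  { destruct (Rle_dec (v - d) (PI / 2)).
    - apply Rle_trans with (1 := s1). apply sin_incr_1; lra.
    - apply Rle_trans with (1 := s2). apply sin_decr_1; lra. }
  unfold level_height. replace (v - (v - d)) with d by ring.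
  set (A := d / sin (v - d)).
  assert (HA0 : 0 < A) by (apply Rdiv_lt_0_compat; lra).
  assert (HA : A <= Rmin 1 (exp (u - 3))).
  { apply Rmult_le_reg_r with (sin (v - d)); [lra|]. unfold A, Rdiv.
    rewrite Rmult_assoc, Rinv_l, Rmult_1_r by lra.
    apply Rle_trans with (1 := d2). rewrite Rmult_comm.
    apply Rmult_le_compat_l; lra. }
  assert (m1 := Rmin_l 1 (exp (u - 3))). assert (m2 := Rmin_r 1 (exp (u - 3))).
  assert (L : ln A <= u - 3).
  { rewrite <- (ln_exp (u - 3)). apply ln_le; lra. }
  assert (C1 := COS_bound (v - d)). nra.
Qed.

(** As [y] tends to [PI] the modulus tends to infinity and the cosine to [-1]; the
    linear term beats the logarithm. *)
Lemma level_height_small_gt_PI (v u : R) :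
  PI < v -> exists y, 0 < y < PI /\ level_height v y < u.
Proof.
  intros HP. assert (P := PI2_3_2).
  set (B := 4 * Rabs (ln 4 - u) + 1).
  assert (HB : 0 < B) by (unfold B; assert (K := Rabs_pos (ln 4 - u)); lra).
  set (e := Rmin 1 ((v - PI) / B)).
  assert (He : 0 < e) by (apply Rmin_pos; [lra|apply Rdiv_lt_0_compat; lra]).
  assert (e1 : e <= 1) by apply Rmin_l.
  assert (e2 : e <= (v - PI) / B) by apply Rmin_r.
  exists (PI - e). split; [lra|].
  unfold level_height. rewrite sin_PI_x, Rtrigo_facts.cos_pi_minus.
  assert (Hs : 0 < sin e) by (apply sin_gt_0; lra).
  assert (Hse := sin_lt_x e He).
  assert (Hc := cos_ge_half e ltac:(lra)).
  set (A := (v - (PI - e)) / sin e).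
  assert (HA : B <= A).
  { apply Rmult_le_reg_r with (sin e); [exact Hs|]. unfold A, Rdiv.
    rewrite Rmult_assoc, Rinv_l, Rmult_1_r by lra.
    apply Rle_trans with (B * ((v - PI) / B)).
    - apply Rmult_le_compat_l; lra.
    - replace (B * ((v - PI) / B)) with (v - PI) by (field; lra). lra. }
  assert (L : ln A <= ln 4 + A / 4 - 1).
  { replace A with (4 * (A / 4)) at 1 by field. rewrite ln_mult by lra.
    assert (K := ln_le_sub_1 (A / 4) ltac:(lra)). lra. }
  assert (Q := Rle_abs (ln 4 - u)). 
  assert (A * (1 / 2) <= A * cos e) by (apply Rmult_le_compat_l; lra).
  unfold B in HA. lra.
Qed.

(** On the line of the slit the modulus tends to [1] as [y] tends to [PI], and the
    height to [0]: the tip of the slit. *)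
Lemma level_height_small_PI (u : R) :
  0 < u -> exists y, 0 < y < PI /\ level_height PI y < u.
Proof.
  intros Hu. assert (P := PI2_3_2).
  set (e := Rmin 1 (u / 4)).
  assert (He : 0 < e) by (apply Rmin_pos; lra).
  assert (e1 : e <= 1) by apply Rmin_l.
  assert (e2 : e <= u / 4) by apply Rmin_r.
  exists (PI - e). split; [lra|].
  unfold level_height. rewrite sin_PI_x, Rtrigo_facts.cos_pi_minus.
  replace (PI - (PI - e)) with e by ring.
  assert (Hs : 0 < sin e) by (apply sin_gt_0; lra).
  assert (Hse := sin_lt_x e He).
  assert (Hc := cos_ge_half e ltac:(lra)).
  assert (Hcs := x_cos_le_sin e ltac:(lra)).
  set (A := e / sin e). set (c := cos e) in *.
  assert (A1 : 1 <= A).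
  { apply Rmult_le_reg_r with (sin e); [exact Hs|]. unfold A, Rdiv.
    rewrite Rmult_assoc, Rinv_l by lra. lra. }
  assert (A2 : A <= / c).
  { apply Rmult_le_reg_r with (sin e); [exact Hs|]. unfold A, Rdiv.
    rewrite Rmult_assoc, Rinv_l by lra.
    apply Rmult_le_reg_r with c; [lra|].
    replace (/ c * sin e * c) with (sin e) by (field; lra). lra. }
  assert (L := ln_le_sub_1 A ltac:(lra)).
  assert (T : / c - c <= 2 * (e * e)).
  { replace (/ c - c) with ((1 - c * c) * / c) by (field; lra).
    assert (Q : 1 - c * c = sin e * sin e).
    { assert (Q := sin2_cos2 e). unfold Rsqr in Q. fold c in Q. lra. }
    rewrite Q. assert (I : / c <= 2).
    { replace 2 with (/ (1 / 2)) by lra. apply Rinv_le_contravar; lra. }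
    assert (I0 : 0 < / c) by (apply Rinv_0_lt_compat; lra).
    assert (sin e * sin e <= e * e) by (apply Rmult_le_compat; lra). nra. }
  nra.
Qed.

Lemma Kw_onto (p : C) : slit_half_plane p -> exists w, upper_half_plane w /\ Kw w = p.
Proof.
  intros Hp. apply slit_iff in Hp. destruct p as [u v]. simpl in Hp.
  destruct Hp as [Hv Hu].
  assert (B : exists y2, 0 < y2 < PI /\ y2 < v /\ level_height v y2 < u).
  { destruct (Rtotal_order v PI) as [L|[->|L]].
    - destruct (level_height_small_lt_PI v u Hv L) as [y [Hy K]].
      exists y. repeat split; lra.
    - destruct (level_height_small_PI u (Hu eq_refl)) as [y [Hy K]].
      exists y. repeat split; lra.
    - destruct (level_height_small_gt_PI v u L) as [y [Hy K]].
      exists y. repeat split; lra. }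
  destruct B as [y2 [H2 [H2v K2]]].
  destruct (level_height_large v u y2 Hv ltac:(lra)) as [y1 [H1 [H1v [H1P K1]]]].
  destruct (Ranalysis5.IVT_interv (fun y => u - level_height v y) y1 y2)
    as [y [Hy E]]; try lra.
  { intros y Hy. assert (Hs : 0 < sin y) by (apply sin_gt_0; lra).
    apply derivable_continuous_pt. apply ex_derive_Reals_0.
    unfold level_height. auto_derive. repeat split; try lra.
    apply Rdiv_lt_0_compat; lra. }
  destruct (Kw_level v y) as [w [Hw Ew]]; [lra|lra|].
  exists w. split; [exact Hw|]. rewrite Ew. f_equal. lra.
Qed.

(** * The map [k] and its inverse *)

Lemma k_slit (z : C) : upper_half_plane z -> slit_half_plane (k z).
Proof. intros H. rewrite k_mob by exact H. apply Kw_slit, mob_upper, H. Qed.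

Lemma k_inj (z1 z2 : C) :
  upper_half_plane z1 -> upper_half_plane z2 -> k z1 = k z2 -> z1 = z2.
Proof.
  intros H1 H2 E. rewrite !k_mob in E by assumption.
  apply Kw_inj in E; [|apply mob_upper; assumption|apply mob_upper; assumption].
  rewrite <- (unmob_mob z1), <- (unmob_mob z2) by assumption. f_equal. exact E.
Qed.

Lemma k_inv_spec (p : C) :
  slit_half_plane p -> upper_half_plane (k_inv p) /\ k (k_inv p) = p.
Proof.
  intros Hp. unfold k_inv. apply epsilon_spec.
  destruct (Kw_onto p Hp) as [w [Hw E]]. exists (unmob w).
  assert (Hu := unmob_upper w Hw). split; [exact Hu|].
  rewrite k_mob, mob_unmob by assumption. exact E.
Qed.

Lemma k_inv_k (z : C) : upper_half_plane z -> k_inv (k z) = z.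
Proof.
  intros H. destruct (k_inv_spec (k z) (k_slit z H)) as [H1 H2].
  apply k_inj; assumption.
Qed.

Lemma locally_upper (z : C) : upper_half_plane z -> locally z upper_half_plane.
Proof.
  intros H. apply locally_Cmod. exists (Im z). split; [exact H|]. intros x Hx.
  assert (K := Rle_lt_trans _ _ _ (im_le_Cmod _) Hx). rewrite im_minus in K.
  apply Rabs_def2 in K. unfold upper_half_plane. lra.
Qed.

Lemma locally_slit (p : C) : slit_half_plane p -> locally p slit_half_plane.
Proof.
  intros Hp. apply slit_iff in Hp. destruct Hp as [Hv Hu].
  assert (B : exists d, 0 < d /\ forall q : C,
            Cmod (q - p)%C < d -> Im q = PI -> 0 < Re q).
  { destruct (Req_dec (Im p) PI) as [E|N].
    - exists (Re p). split; [apply Hu, E|]. intros q Hq _.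
      assert (K := Rle_lt_trans _ _ _ (re_le_Cmod _) Hq). rewrite re_minus in K.
      apply Rabs_def2 in K. lra.
    - exists (Rabs (Im p - PI)). split; [apply Rabs_pos_lt; lra|]. intros q Hq E.
      assert (K := Rle_lt_trans _ _ _ (im_le_Cmod _) Hq).
      rewrite im_minus, E, Rabs_minus_sym in K. lra. }
  destruct B as [d [Hd B]].
  generalize (filter_and _ _ (locally_upper p Hv) (vanishing_locally p d Hd)).
  apply filter_imp. intros q [H1 H2]. apply slit_iff. split; [exact H1|].
  apply B, H2.
Qed.

Lemma complex_deriv_id (a : C) : complex_deriv (fun x => x) a (RtoC 1).
Proof. apply deriv_along_id; [typeclasses eauto|].
  change (forall x : C, x = a + (x - a))%C. intros x. ring. Qed.

Lemma complex_deriv_mob (z : C) :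
  upper_half_plane z -> complex_deriv mob z (2 / ((2 - z) * (2 - z)))%C.
Proof.
  intros H. assert (N := sub_2_neq_0 z H).
  assert (K := deriv_along_scal _ _ _ _ _ (RtoC 2)
    (deriv_along_inv _ _ _ _ _ (vanishing_locally z) N
      (deriv_along_minus _ _ _ _ _ _ _ _ (deriv_along_const _ _ (RtoC 2))
        (complex_deriv_id z)))).
  revert K. apply deriv_along_ext; [typeclasses eauto| |field; exact N].
  apply filter_forall. reflexivity.
Qed.

Lemma complex_deriv_unmob (w : C) :
  w <> RtoC 0 -> complex_deriv unmob w (2 / (w * w))%C.
Proof.
  intros N.
  assert (K := deriv_along_minus _ _ _ _ _ _ _ _ (deriv_along_const _ _ (RtoC 2))
    (deriv_along_scal _ _ _ _ _ (RtoC 2) (complex_deriv_inv w N))).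
  revert K. apply deriv_along_ext; [typeclasses eauto| |field; exact N].
  apply filter_forall. reflexivity.
Qed.

Lemma sub_4_neq_0 (z : C) : upper_half_plane z -> (4 - z)%C <> RtoC 0.
Proof.
  intros H E. apply (f_equal Im) in E. rewrite im_minus, !im_RtoC in E.
  unfold upper_half_plane in H. lra.
Qed.

Lemma complex_deriv_k (z : C) :
  upper_half_plane z -> complex_deriv k z ((4 - z) / ((2 - z) * (2 - z)))%C.
Proof.
  intros H. assert (N := sub_2_neq_0 z H).
  assert (K := deriv_along_comp _ _ _ _ _ _ _ (vanishing_locally z)
    (complex_deriv_Kw _ (mob_upper z H)) (complex_deriv_mob z H)).
  unfold complex_deriv. rewrite k_mob by exact H. revert K.
  apply deriv_along_ext; [typeclasses eauto| |].
  - generalize (locally_upper z H). apply filter_imp. intros x Hx.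
    symmetry. apply k_mob, Hx.
  - unfold mob. field. exact N.
Qed.

Lemma mob_k_inv_cont (p : C) :
  slit_half_plane p -> filterlim (fun q => mob (k_inv q)) (locally p)
    (locally (mob (k_inv p))).
Proof.
  intros Hp. destruct (k_inv_spec p Hp) as [Hz Ez].
  destruct (Kw_separates _ (mob_upper _ Hz)) as [c [d [Hc [Hd S]]]].
  apply filterlim_Cmod; [typeclasses eauto|]. intros eps He.
  assert (Hm : 0 < c * Rmin eps d).
  { apply Rmult_lt_0_compat; [exact Hc|]. apply Rmin_pos; assumption. }
  generalize (filter_and _ _ (locally_slit p Hp) (vanishing_locally p _ Hm)).
  apply filter_imp. intros q [Hq Hqp].
  destruct (k_inv_spec q Hq) as [Hz' Ez'].
  specialize (S _ (mob_upper _ Hz')).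
  rewrite <- !k_mob, Ez, Ez' in S by assumption.
  assert (L := Rle_lt_trans _ _ _ S Hqp).
  apply Rmult_lt_reg_l in L; [|exact Hc].
  unfold Rmin in L. destruct (Rle_dec _ d), (Rle_dec eps d); lra.
Qed.

Lemma complex_deriv_k_inv (p : C) :
  slit_half_plane p ->
  complex_deriv k_inv p ((2 - k_inv p) * (2 - k_inv p) / (4 - k_inv p))%C.
Proof.
  intros Hp. destruct (k_inv_spec p Hp) as [Hz Ez]. set (z := k_inv p) in *.
  assert (Hw := mob_upper z Hz).
  assert (N2 := sub_2_neq_0 z Hz). assert (N4 := sub_4_neq_0 z Hz).
  assert (DJ : complex_deriv (fun q => mob (k_inv q)) p (/ (1 + / mob z))%C).
  { apply complex_deriv_inverse with (f := Kw).
    - apply complex_deriv_Kw, Hw.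
    - apply Kw_deriv_neq_0, Hw.
    - apply mob_k_inv_cont, Hp.
    - generalize (locally_slit p Hp). apply filter_imp. intros q Hq.
      destruct (k_inv_spec q Hq) as [Hz' Ez']. rewrite <- k_mob by exact Hz'.
      exact Ez'. }
  assert (K := deriv_along_comp _ _ _ _ _ _ _ (vanishing_locally p)
    (complex_deriv_unmob _ (upper_neq_0 _ Hw)) DJ).
  unfold complex_deriv. fold z. rewrite <- (unmob_mob z Hz) at 1. revert K.
  apply deriv_along_ext; [typeclasses eauto| |].
  - generalize (locally_slit p Hp). apply filter_imp. intros q Hq.
    destruct (k_inv_spec q Hq) as [Hz' _]. apply unmob_mob, Hz'.
  - assert (Nw := upper_neq_0 _ Hw). assert (Nd := Kw_deriv_neq_0 _ Hw).
    unfold mob in *. field.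
    repeat split; auto.
Qed.

Lemma k_conformal : conformal_onto k upper_half_plane slit_half_plane.
Proof.
  split; [|split].
  - intros z Hz. exists ((4 - z) / ((2 - z) * (2 - z)))%C. split.
    + apply complex_deriv_is_derive, complex_deriv_k, Hz.
    + assert (N2 := sub_2_neq_0 z Hz). assert (N4 := sub_4_neq_0 z Hz).
      unfold Cdiv. apply Cmult_neq_0; [exact N4|].
      intros E. apply (Cmult_neq_0 _ _ N2) in N2 as N.
      apply (f_equal (Cmult ((2 - z) * (2 - z)))) in E.
      rewrite Cinv_r, Cmult_0_r in E by exact N. apply C1_nz in E. exact E.
  - exact k_inj.
  - intros p. split.
    + intros Hp. exists (k_inv p). apply k_inv_spec, Hp.
    + intros [z [Hz <-]]. apply k_slit, Hz.
Qed.

(** * The explicit flow *)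

(** Shift of the [k]-coordinate performed by the flow up to time [t]. *)
Definition shift (t : R) : R := 1 / 2 * ln (1 - t).

Definition scale (t : R) : C := RtoC (sqrt (1 - t)).

Lemma scale_neq_0 (t : R) : t < 1 -> scale t <> RtoC 0.
Proof.
  intros H. apply RtoC_neq_0. assert (K := sqrt_lt_R0 (1 - t)). lra.
Qed.

Lemma deriv_scale (D : R -> Prop) (t : R) :
  t < 1 -> deriv_within D scale t (- / (2 * scale t))%C.
Proof.
  intros H. assert (K := sqrt_lt_R0 (1 - t) ltac:(lra)).
  unfold scale. rewrite <- RtoC_mult, <- RtoC_inv, <- RtoC_opp by lra.
  apply is_derive_deriv_within. auto_derive; [lra|]. unfold Rminus in *. field. lra.
Qed.

Lemma deriv_shift (D : R -> Prop) (t : R) :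
  t < 1 -> deriv_within D (fun s => RtoC (shift s)) t (- / (2 * (scale t * scale t)))%C.
Proof.
  intros H. assert (K := sqrt_lt_R0 (1 - t) ltac:(lra)).
  assert (E : sqrt (1 - t) * sqrt (1 - t) = 1 - t) by (apply sqrt_sqrt; lra).
  unfold scale. rewrite <- !RtoC_mult, E, <- RtoC_inv, <- RtoC_opp by lra.
  apply is_derive_deriv_within. unfold shift. auto_derive; [lra|]. unfold Rminus in *. field. lra.
Qed.

Lemma shift_0 : shift 0 = 0.
Proof. unfold shift. rewrite Rminus_0_r, ln_1. ring. Qed.

Lemma shift_decreasing (s t : R) : s < t -> t < 1 -> shift t < shift s.
Proof.
  intros H1 H2. unfold shift.
  assert (K := ln_increasing (1 - t) (1 - s) ltac:(lra) ltac:(lra)). lra.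
Qed.

Lemma shift_antitone (s t : R) : s <= t -> t < 1 -> shift t <= shift s.
Proof.
  intros [H1| ->] H2; [|lra]. apply Rlt_le, shift_decreasing; assumption.
Qed.

Lemma g_eq (t : R) (z : C) :
  g t z = (scale t * k_inv (k z + RtoC (shift t)))%C.
Proof. reflexivity. Qed.

Lemma driving_4 (t : R) : RtoC (driving 4 t) = (4 * scale t)%C.
Proof. unfold driving, scale. apply RtoC_mult. Qed.

Definition shift_in_slit (t : R) (z : C) : Prop :=
  slit_half_plane (k z + RtoC (shift t))%C.

Lemma shift_onto (x : R) : 0 < x -> exists s, 0 < s < 1 /\ shift s = - x.
Proof.
  intros H. exists (1 - exp (- (2 * x))).
  assert (E1 : exp (- (2 * x)) < 1) by (rewrite <- exp_0; apply exp_increasing; lra).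
  assert (E2 := exp_pos (- (2 * x))). split; [lra|].
  unfold shift. replace (1 - (1 - exp (- (2 * x)))) with (exp (- (2 * x))) by ring.
  rewrite ln_exp. field.
Qed.

Lemma shift_in_slit_iff (t : R) (z : C) :
  0 <= t < 1 -> upper_half_plane z ->
  (shift_in_slit t z <-> ~ exists x, 0 < x <= - shift t /\ k z = (x, PI)).
Proof.
  intros Ht Hz. unfold shift_in_slit. rewrite slit_iff.
  rewrite im_plus, re_plus, im_RtoC, re_RtoC, Rplus_0_r.
  destruct (slit_elim _ (k_slit z Hz)) as [K1 K2].
  split.
  - intros [_ H] [x [Hx E]]. rewrite E in H. simpl in H.
    assert (0 < x + shift t) by (apply H; reflexivity). lra.
  - intros N. split; [exact K1|]. intros E. apply Rnot_le_lt. intros L. apply N.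
    exists (Re (k z)). split; [assert (K := K2 E); lra|].
    rewrite <- E. destruct (k z); reflexivity.
Qed.

Lemma shift_in_slit_mono (s t : R) (z : C) :
  0 <= s <= t -> t < 1 -> upper_half_plane z -> shift_in_slit t z -> shift_in_slit s z.
Proof.
  intros Hs Ht Hz. rewrite !shift_in_slit_iff by (exact Hz || lra).
  intros N [x [Hx E]]. apply N. exists x. split; [|exact E].
  assert (K := shift_antitone s t ltac:(lra) Ht). lra.
Qed.

Lemma g_0 (z : C) : upper_half_plane z -> g 0 z = z.
Proof.
  intros Hz. rewrite g_eq, shift_0. unfold scale.
  rewrite Rminus_0_r, sqrt_1, Cplus_0_r, k_inv_k by exact Hz. ring.
Qed.

Lemma upper_unscale (t : R) (w : C) :
  t < 1 -> upper_half_plane w -> upper_half_plane (w / scale t)%C.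
Proof.
  intros Ht H. assert (K := sqrt_lt_R0 (1 - t) ltac:(lra)).
  unfold Cdiv. rewrite Cmult_comm. unfold scale. rewrite <- RtoC_inv by lra.
  apply upper_scal; [apply Rinv_0_lt_compat, K|exact H].
Qed.

Lemma g_upper (t : R) (z : C) :
  t < 1 -> shift_in_slit t z -> upper_half_plane (g t z).
Proof.
  intros Ht Hp. rewrite g_eq. apply upper_scal; [apply sqrt_lt_R0; lra|].
  apply k_inv_spec, Hp.
Qed.

Lemma upper_neq_real (z : C) (x : R) : upper_half_plane z -> z <> RtoC x.
Proof.
  intros H E. unfold upper_half_plane in H. rewrite E, im_RtoC in H. lra.
Qed.

Lemma g_loewner (D : R -> Prop) (t : R) (z : C) :
  t < 1 -> shift_in_slit t z ->
  deriv_within D (fun s => g s z) t (2 / (g t z - RtoC (driving 4 t)))%C.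
Proof.
  intros Ht Hp. destruct (k_inv_spec _ Hp) as [Hz _].
  assert (Nc := scale_neq_0 t Ht).
  assert (N := sub_4_neq_0 _ Hz).
  assert (A := deriv_along_plus _ _ _ _ _ _ _ _
    (deriv_along_const _ _ (k z)) (deriv_shift D t Ht)).
  assert (B := deriv_along_comp _ _ _ _ _ _ _ (vanishing_within D t)
    (complex_deriv_k_inv _ Hp) A).
  assert (G := deriv_along_mult _ _ _ _ _ _ _ _ (vanishing_within D t)
    (deriv_scale D t Ht) B).
  revert G. rewrite driving_4. unfold deriv_within. rewrite (g_eq t z).
  apply deriv_along_ext; [typeclasses eauto|apply filter_forall; reflexivity|].
  set (zt := k_inv _) in *. field. split; [|split]; auto.
  replace (scale t * zt - 4 * scale t)%C with (- (scale t * (4 - zt)))%C by ring.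
  intros E. apply (Cmult_neq_0 _ _ Nc N). 
  replace (scale t * (4 - zt))%C with (- - (scale t * (4 - zt)))%C by ring.
  rewrite E. ring.
Qed.

Lemma driving_cont (kap t : R) : t < 1 -> continuity_pt (driving kap) t.
Proof.
  intros H. apply derivable_continuous_pt, ex_derive_Reals_0.
  unfold driving. auto_derive. lra.
Qed.

Lemma Im_2_div (v : C) : v <> RtoC 0 -> Im (2 / v)%C = - (2 / Cmod v ^ 2) * Im v.
Proof.
  intros N. assert (Hm : 0 < Cmod v ^ 2) by (apply pow_lt, Cmod_gt_0, N).
  rewrite Cmod2_alt in *. destruct v as [x y].
  unfold Cdiv, Cinv, Cmult, RtoC. simpl in *. field. lra.
Qed.

(** * Solutions of the Loewner equation and their hulls *)

(** A first time [s1] of contact with the real axis is impossible: just before it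
    [(log (Im u))'] is bounded, since [u] keeps away from the driving point. *)
Lemma loewner_solution_upper (lam : R -> R) (z : C) (t : R) (u : R -> C) :
  (forall s, 0 <= s <= t -> continuity_pt lam s) ->
  upper_half_plane z -> loewner_solution lam z t u ->
  forall s, 0 <= s <= t -> upper_half_plane (u s).
Proof.
  intros Hlam Hz [H0 Hu] s Hs. apply NNPP. intros Neg.
  assert (Hd : forall D r, (forall x, D x -> 0 <= x <= t) -> 0 <= r <= t ->
            deriv_within D u r (2 / (u r - RtoC (lam r)))%C).
  { intros D r HD Hr. destruct (Hu r Hr) as [_ K].
    apply deriv_within_is_derive_within in K; [|exact Hr].
    revert K. apply deriv_within_subset, HD. }
  destruct (first_exit (fun r => - Im (u r)) s 0) as [s1 [Hs1 [E1 Hlt]]].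
  { lra. }
  { intros r Hr eps He.
    destruct (deriv_within_cont _ _ _ _
      (Hd (fun x => 0 <= x <= t) r ltac:(auto) ltac:(lra)) eps He) as [d [Hd0 K]].
    exists d. split; [exact Hd0|]. intros x Hx Hxr.
    replace (- Im (u x) - - Im (u r)) with (- Im (u x - u r)) by (rewrite im_minus; ring).
    rewrite Rabs_Ropp. eapply Rle_lt_trans; [apply im_le_Cmod|]. apply K; [lra|exact Hxr]. }
  { rewrite H0. unfold upper_half_plane in Hz. lra. }
  { unfold upper_half_plane in Neg. lra. }
  assert (Hs1t : 0 <= s1 <= t) by lra.
  set (d := Cmod (u s1 - RtoC (lam s1))).
  assert (Hd0 : 0 < d) by (apply Cmod_gt_0, Cminus_eq_contra, Hu, Hs1t).
  destruct (deriv_within_cont _ _ _ _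
    (Hd (fun x => 0 <= x <= t) s1 ltac:(auto) Hs1t) (d / 4) ltac:(lra)) as [d1 [Hd1 K1]].
  destruct (Hlam s1 Hs1t (d / 4) ltac:(lra)) as [d2 [Hd2 K2]].
  (* On the last [eta] time units [Im u] loses at most half of its value. *)
  set (eta := Rmin s1 (Rmin (Rmin d1 d2 / 2) (d ^ 2 / 16))).
  assert (Hd12 : 0 < Rmin d1 d2) by (apply Rmin_pos; assumption).
  assert (Hdd : 0 < d ^ 2) by (apply pow_lt, Hd0).
  assert (Heta : 0 < eta) by (repeat apply Rmin_pos; lra).
  assert (eta1 : eta <= s1) by apply Rmin_l.
  assert (eta2 : eta <= Rmin d1 d2 / 2)
    by (eapply Rle_trans; [apply Rmin_r|apply Rmin_l]).
  assert (eta3 : eta <= d ^ 2 / 16)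
    by (eapply Rle_trans; [apply Rmin_r|apply Rmin_r]).
  assert (md1 := Rmin_l d1 d2). assert (md2 := Rmin_r d1 d2).
  set (s0 := s1 - eta).
  assert (Himge : forall r, 0 <= r <= s1 -> 0 <= Im (u r)).
  { intros r Hr. destruct (Req_dec r s1) as [->|N]; [lra|].
    assert (K := Hlt r ltac:(lra)). lra. }
  assert (Hrate : forall r, s0 <= r <= s1 ->
    - (8 / d ^ 2) * Im (u r) <= Im (2 / (u r - RtoC (lam r)))%C <= 0).
  { intros r Hr. unfold s0 in Hr.
    assert (Hr1 : Rabs (r - s1) < d1 /\ Rabs (r - s1) < d2).
    { rewrite Rabs_left1 by lra. lra. }
    assert (B1 : Cmod (u r - u s1) < d / 4) by (apply K1; [lra|apply Hr1]).
    assert (B2 : Rabs (lam r - lam s1) < d / 4).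
    { destruct (Req_dec r s1) as [->|N].
      - rewrite Rminus_diag, Rabs_R0. lra.
      - apply K2. split; [|apply Hr1]. split; [exact I|auto]. }
    set (v := (u r - RtoC (lam r))%C).
    assert (Bv : d / 2 <= Cmod v).
    { assert (T1 := Cmod_sub_ge (u s1 - RtoC (lam s1)) ((u s1 - u r) - RtoC (lam s1 - lam r))).
      rewrite RtoC_minus in T1.
      replace (u s1 - RtoC (lam s1) - (u s1 - u r - (RtoC (lam s1) - RtoC (lam r))))%C
        with v in T1 by (unfold v; ring). fold d in T1.
      assert (T2 := Cmod_triangle (u s1 - u r) (- RtoC (lam s1 - lam r))).
      rewrite Cmod_opp, Cmod_R, Rabs_minus_sym in T2.
      replace (u s1 - u r)%C with (- (u r - u s1))%C in T2 at 2 by ring.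
      rewrite Cmod_opp in T2. rewrite <- RtoC_minus in T1. unfold Cminus in T1, T2, B1.
      unfold Cminus. lra. }
    assert (Nv : v <> RtoC 0) by (apply Cmod_gt_0; lra).
    assert (Iv : Im v = Im (u r)) by (unfold v; rewrite im_minus, im_RtoC; ring).
    assert (Ir := Himge r ltac:(lra)).
    rewrite Im_2_div, Iv by exact Nv.
    assert (V2 : (d / 2) ^ 2 <= Cmod v ^ 2) by (apply pow_incr; lra).
    assert (V3 : 0 < (d / 2) ^ 2) by (apply pow_lt; lra).
    assert (Q : 0 < 2 / Cmod v ^ 2 <= 8 / d ^ 2).
    { split; [apply Rdiv_lt_0_compat; lra|].
      replace (8 / d ^ 2) with (2 * / (d / 2) ^ 2) by (field; lra).
      apply Rmult_le_compat_l; [lra|]. apply Rinv_le_contravar; assumption. }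
    nra. }
  assert (Hmv : forall a b, s0 <= a -> a < b -> b <= s1 -> exists c, a <= c <= b /\
    Im (u b) - Im (u a) = Im (2 / (u c - RtoC (lam c)))%C * (b - a)).
  { intros a b Ha Hab Hb. unfold s0 in Ha.
    apply (mean_value_Im_within u (fun r => 2 / (u r - RtoC (lam r)))%C a b Hab).
    intros r Hr. apply Hd; [intros x Hx; lra|lra]. }
  assert (Hs0 : 0 < Im (u s0)) by (assert (K := Hlt s0 ltac:(unfold s0; lra)); lra).
  destruct (Hmv s0 s1) as [c [Hc Ec]]; try (unfold s0; lra).
  assert (Hdec : Im (u c) <= Im (u s0)).
  { destruct (Req_dec s0 c) as [<-|N]; [lra|].
    destruct (Hmv s0 c) as [c' [Hc' Ec']]; try lra.
    assert (K := Hrate c' ltac:(lra)). nra. }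
  assert (Hrc := Hrate c Hc).
  replace (s1 - s0) with eta in Ec by (unfold s0; ring).
  assert (F1 : 8 / d ^ 2 * Im (u c) <= 8 / d ^ 2 * Im (u s0)).
  { apply Rmult_le_compat_l; [|exact Hdec]. apply Rlt_le, Rdiv_lt_0_compat; lra. }
  assert (F2 : 8 / d ^ 2 * eta <= 1 / 2).
  { replace (1 / 2) with (8 / d ^ 2 * (d ^ 2 / 16)) by (field; lra).
    apply Rmult_le_compat_l; [|exact eta3]. apply Rlt_le, Rdiv_lt_0_compat; lra. }
  set (q := 8 / d ^ 2) in *. nra.
Qed.

(** In the rescaled coordinate [u / sqrt (1 - s)] the equation becomes
    autonomous and [k] linearizes it. *)
Lemma k_conserved (z : C) (t : R) (u : R -> C) :
  0 <= t < 1 -> upper_half_plane z -> loewner_solution (driving 4) z t u ->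
  k (u t / scale t)%C = (k z + RtoC (shift t))%C.
Proof.
  intros Ht Hz Hsol.
  assert (Hlam : forall s, 0 <= s <= t -> continuity_pt (driving 4) s)
    by (intros s Hs; apply driving_cont; lra).
  assert (Hup := loewner_solution_upper _ _ _ _ Hlam Hz Hsol).
  destruct Hsol as [H0 Hu].
  assert (E0 : (u 0 / scale 0)%C = z).
  { rewrite H0. unfold scale. rewrite Rminus_0_r, sqrt_1. field. }
  destruct (Req_dec t 0) as [->|Nt].
  { rewrite E0, shift_0. ring. }
  assert (K := constant_within (fun s => k (u s / scale s) - RtoC (shift s))%C 0 t
    ltac:(lra)).
  cbv beta in K. rewrite E0, shift_0 in K.
  replace (k (u t / scale t)%C)
    with (k (u t / scale t) - RtoC (shift t) + RtoC (shift t))%C by ring.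
  rewrite K; [ring|]. clear K. intros s Hs.
  destruct (Hu s Hs) as [_ Hds]. apply deriv_within_is_derive_within in Hds; [|exact Hs].
  assert (Hs1 : s < 1) by lra.
  assert (Nc := scale_neq_0 s Hs1).
  assert (Hus := Hup s Hs).
  assert (Nu : (u s - 4 * scale s)%C <> RtoC 0).
  { rewrite <- driving_4. apply Cminus_eq_contra, upper_neq_real, Hus. }
  assert (Hz' := upper_unscale s _ Hs1 Hus).
  rewrite driving_4 in Hds.
  assert (A := deriv_along_mult _ _ _ _ _ _ _ _ (vanishing_within _ s) Hds
    (deriv_along_inv _ _ _ _ _ (vanishing_within _ s) Nc
       (deriv_scale _ s Hs1))).
  assert (B := deriv_along_minus _ _ _ _ _ _ _ _
    (deriv_along_comp _ _ _ _ _ _ _ (vanishing_within _ s)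
      (complex_deriv_k _ Hz') A)
    (deriv_shift (fun r => 0 <= r <= t) s Hs1)).
  unfold deriv_within. revert B.
  apply deriv_along_ext; [typeclasses eauto|apply filter_forall; reflexivity|].
  assert (N2 := sub_2_neq_0 _ Hz'). unfold Cdiv in *.
  assert (N2' : (2 * scale s - u s)%C <> RtoC 0).
  { intros E. apply N2.
    replace (2 - u s * / scale s)%C with ((2 * scale s - u s) * / scale s)%C
      by (field; exact Nc).
    rewrite E. ring. }
  field. auto.
Qed.

(** If [k z = (x, PI)], the shifted point would reach [(0, PI)], a value that [k]
    omits, at the time [s] with [shift s = - x]. *)
Lemma hull_4 (t : R) (z : C) :
  0 <= t < 1 ->
  (loewner_hull (driving 4) t z <->
   upper_half_plane z /\ exists x, 0 < x <= - shift t /\ k z = (x, PI)).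
Proof.
  intros Ht. split.
  - intros [Hz Hno]. split; [exact Hz|]. apply NNPP. intros N. apply Hno.
    assert (Hsl : forall s, 0 <= s <= t -> shift_in_slit s z).
    { intros s Hs. apply shift_in_slit_mono with t; auto; try lra.
      apply shift_in_slit_iff; assumption. }
    exists (fun s => g s z). split.
    + apply g_0, Hz.
    + intros s Hs. assert (Hp := Hsl s Hs). split.
      * apply upper_neq_real, g_upper; [lra|exact Hp].
      * apply deriv_within_is_derive_within; [exact Hs|].
        apply g_loewner; [lra|exact Hp].
  - intros [Hz [x [Hx E]]]. split; [exact Hz|]. intros [u Hu].
    destruct (shift_onto x ltac:(lra)) as [s [Hs01 Es]].
    assert (Hst : s <= t).
    { apply Rnot_lt_le. intros L. assert (K := shift_decreasing t s L ltac:(lra)).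
      lra. }
    assert (Hs : 0 <= s < 1) by lra.
    assert (Hu' : loewner_solution (driving 4) z s u).
    { destruct Hu as [H0 Hu]. split; [exact H0|]. intros r Hr.
      destruct (Hu r ltac:(lra)) as [N D]. split; [exact N|].
      apply deriv_within_is_derive_within; [exact Hr|].
      apply deriv_within_is_derive_within in D; [|lra].
      revert D. apply deriv_within_subset. intros y Hy; lra. }
    assert (K := k_conserved z s u Hs Hz Hu').
    assert (Hlam : forall r, 0 <= r <= s -> continuity_pt (driving 4) r)
      by (intros r Hr; apply driving_cont; lra).
    assert (Hup := loewner_solution_upper _ _ _ _ Hlam Hz Hu' s ltac:(lra)).
    assert (Hz' := upper_unscale s _ ltac:(lra) Hup).
    destruct (slit_elim _ (k_slit _ Hz')) as [_ Q].
    rewrite K, E, Es in Q. unfold Cplus, RtoC in Q. simpl in Q.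
    assert (0 < x + - x) by (apply Q; ring). lra.
Qed.

(** * The trace *)

Lemma Cmod_le_abs (x y : R) : Cmod (x, y) <= Rabs x + Rabs y.
Proof.
  replace ((x, y) : C) with (RtoC x + Ci * RtoC y)%C
    by (unfold RtoC, Ci, Cplus, Cmult; simpl; f_equal; ring).
  eapply Rle_trans; [apply Cmod_triangle|].
  rewrite Cmod_mult, Cmod_Ci, !Cmod_R. lra.
Qed.

Lemma shift_neg (t : R) : 0 < t < 1 -> shift t < 0.
Proof. intros H. rewrite <- shift_0. apply shift_decreasing; lra. Qed.

(** The preimage of the ray under [k], with parameter
    the imaginary part of [2 / (2 - z)]. *)
Definition ray_curve (th : R) : C :=
  (2 + 2 * sin th * cos th / th, 2 * (sin th * sin th) / th).

Lemma ray_curve_param (z : C) (x : R) :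
  upper_half_plane z -> k z = (x, PI) ->
  exists th, 0 < th < PI /\ ray_height th = x /\ z = ray_curve th.
Proof.
  intros Hz E. rewrite k_mob in E by exact Hz.
  assert (Hw := mob_upper z Hz).
  destruct (Kw_ray (mob z) Hw) as [Hth [Eh Ew]]; [rewrite E; reflexivity|].
  exists (Im (mob z)). split; [exact Hth|].
  rewrite E in Eh. split; [symmetry; exact Eh|].
  rewrite <- (unmob_mob z Hz) at 1.
  set (th := Im (mob z)) in *. rewrite Ew.
  assert (Hs : 0 < sin th) by (apply sin_gt_0; lra).
  assert (E1 : (th * cos th / sin th) * (th * cos th / sin th) + th * th
               = th * th / (sin th * sin th)).
  { assert (Q := sin2_cos2 th). unfold Rsqr in Q.
    field_simplify_eq; [|lra].
    replace (cos th ^ 2) with (1 - sin th * sin th) by (simpl; lra). ring. }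
  unfold unmob, ray_curve, Cdiv, Cinv, Cminus, Copp, Cplus, Cmult, RtoC. simpl.
  replace (- (th * cos th / sin th) * (- (th * cos th / sin th) * 1) + th * (th * 1))
    with (th * th / (sin th * sin th)) by (rewrite <- E1; ring).
  f_equal; field; lra.
Qed.

Definition trace_4 (t : R) : C :=
  if Rle_dec t 0 then RtoC 4 else k_inv (- shift t, PI).

Lemma trace_4_0 : trace_4 0 = RtoC 4.
Proof. unfold trace_4. destruct (Rle_dec 0 0); [reflexivity|lra]. Qed.

Lemma trace_4_pos (t : R) : 0 < t -> trace_4 t = k_inv (- shift t, PI).
Proof. intros H. unfold trace_4. destruct (Rle_dec t 0); [lra|reflexivity]. Qed.

Lemma ray_slit (t : R) : 0 < t < 1 -> slit_half_plane (- shift t, PI).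
Proof.
  intros H. apply slit_intro; [apply PI_RGT_0|]. intros _.
  assert (K := shift_neg t H). lra.
Qed.

Lemma trace_4_spec (t : R) :
  0 < t < 1 -> upper_half_plane (trace_4 t) /\ k (trace_4 t) = (- shift t, PI).
Proof.
  intros H. rewrite trace_4_pos by lra. apply k_inv_spec, ray_slit, H.
Qed.

Lemma trace_4_inj (s t : R) : 0 < s < 1 -> 0 < t < 1 -> trace_4 s = trace_4 t -> s = t.
Proof.
  intros Hs Ht E. destruct (trace_4_spec s Hs) as [_ E1].
  destruct (trace_4_spec t Ht) as [_ E2]. rewrite E, E2 in E1.
  apply (f_equal fst) in E1. simpl in E1.
  destruct (Rtotal_order s t) as [L|[L|L]]; [exfalso|exact L|exfalso].
  - assert (K := shift_decreasing s t L ltac:(lra)). lra.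
  - assert (K := shift_decreasing t s L ltac:(lra)). lra.
Qed.

Lemma arc_trace_4 (t : R) (z : C) :
  0 <= t < 1 ->
  (arc trace_4 t z <->
   upper_half_plane z /\ exists x, 0 < x <= - shift t /\ k z = (x, PI)).
Proof.
  intros Ht. split.
  - intros [s [Hs ->]]. destruct (trace_4_spec s ltac:(lra)) as [H E].
    split; [exact H|]. exists (- shift s). split; [|exact E].
    assert (K := shift_neg s ltac:(lra)).
    assert (K' := shift_antitone s t ltac:(lra) ltac:(lra)). lra.
  - intros [Hz [x [Hx E]]]. destruct (shift_onto x ltac:(lra)) as [s [Hs Es]].
    exists s. split.
    + split; [lra|]. apply Rnot_lt_le. intros L.
      assert (K := shift_decreasing t s L ltac:(lra)). lra.
    + rewrite trace_4_pos, Es, Ropp_involutive, <- E by lra.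
      symmetry. apply k_inv_k, Hz.
Qed.

(** Near time [0] the parameter of the curve is near [0], by
    monotonicity of [ray_height]. *)
Lemma trace_4_start (P : C -> Prop) (e : R) :
  0 < e -> (forall th, 0 < th < e -> th < PI -> P (ray_curve th)) ->
  at_right 0 (fun t => 0 < t < 1 /\ P (trace_4 t)).
Proof.
  intros He H. assert (HP := PI_RGT_0).
  set (e' := Rmin e (PI / 2)).
  assert (He' : 0 < e') by (apply Rmin_pos; lra).
  assert (e1 : e' <= e) by apply Rmin_l.
  assert (e2 : e' <= PI / 2) by apply Rmin_r.
  destruct (shift_onto (ray_height e')) as [s [Hs Es]]; [apply ray_height_pos; lra|].
  exists (mkposreal s (proj1 Hs)). intros t Ht Ht0.
  change (Rabs (t - 0) < s) in Ht. rewrite Rminus_0_r, Rabs_right in Ht by lra.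
  assert (Ht1 : 0 < t < 1) by lra. split; [exact Ht1|].
  destruct (trace_4_spec t Ht1) as [Hu E].
  destruct (ray_curve_param _ _ Hu E) as [th [Hth [Eh ->]]].
  apply H; [|lra]. split; [lra|]. apply Rnot_le_lt. intros L.
  assert (K := shift_decreasing t s Ht ltac:(lra)).
  assert (ray_height e' <= ray_height th); [|lra].
  destruct (Req_dec e' th) as [->|N]; [lra|].
  apply Rlt_le, ray_height_increasing; lra.
Qed.

Lemma trace_4_end (P : C -> Prop) (e : R) :
  0 < e -> (forall th, PI - e < th < PI -> 0 < th -> P (ray_curve th)) ->
  at_left 1 (fun t => 0 < t < 1 /\ P (trace_4 t)).
Proof.
  intros He H. assert (HP := PI_RGT_0).
  set (e' := Rmin e (PI / 2)).
  assert (He' : 0 < e') by (apply Rmin_pos; lra).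
  assert (e1 : e' <= e) by apply Rmin_l.
  assert (e2 : e' <= PI / 2) by apply Rmin_r.
  destruct (shift_onto (ray_height (PI - e'))) as [s [Hs Es]];
    [apply ray_height_pos; lra|].
  assert (Hs1 : 0 < 1 - s) by lra.
  exists (mkposreal _ Hs1). intros t Ht Ht1.
  change (Rabs (t - 1) < 1 - s) in Ht. rewrite Rabs_left in Ht by lra.
  assert (Ht0 : 0 < t < 1) by lra. split; [exact Ht0|].
  destruct (trace_4_spec t Ht0) as [Hu E].
  destruct (ray_curve_param _ _ Hu E) as [th [Hth [Eh ->]]].
  apply H; [|lra]. split; [|lra]. apply Rnot_le_lt. intros L.
  assert (K := shift_decreasing s t ltac:(lra) ltac:(lra)).
  assert (ray_height th <= ray_height (PI - e')); [|lra].
  destruct (Req_dec th (PI - e')) as [->|N]; [lra|].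
  apply Rlt_le, ray_height_increasing; lra.
Qed.

(** From the expansion [4 + 2 i th + O (th^2)]: the horizontal deviation is of
    second order, which makes the angle at [4] right. *)
Lemma ray_curve_near_4 (th : R) :
  0 < th <= 1 ->
  - (2 * th ^ 2) <= Re (ray_curve th - 4)%C <= 0 /\
  th / 2 <= Im (ray_curve th - 4)%C <= 2 * th.
Proof.
  intros H. assert (P := PI2_3_2).
  rewrite re_minus, im_minus, re_RtoC, im_RtoC. unfold ray_curve. simpl Re; simpl Im.
  assert (Hc := cos_ge_half th ltac:(lra)).
  assert (Hs := x_cos_le_sin th ltac:(lra)).
  assert (Hx := sin_lt_x th ltac:(lra)).
  assert (Q := sin2_cos2 th). unfold Rsqr in Q.
  assert (C1 := COS_bound th).
  set (s := sin th) in *. set (c := cos th) in *.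
  assert (Hs0 : th / 2 <= s) by nra.
  assert (A1 : th * (1 - th ^ 2) <= s * c).
  { apply Rle_trans with (th * (c * c)); [|nra]. apply Rmult_le_compat_l; nra. }
  assert (A2 : s * c <= th) by nra.
  assert (B1 : (th / 2) * (th / 2) <= s * s) by (apply Rmult_le_compat; lra).
  assert (B2 : s * s <= th * th) by (apply Rmult_le_compat; lra).
  assert (E1 : 2 + 2 * s * c / th - 4 = 2 * (s * c - th) / th) by (field; lra).
  rewrite E1. assert (I : 0 < / th) by (apply Rinv_0_lt_compat; lra).
  assert (It : th * / th = 1) by (apply Rinv_r; lra).
  split; split.
  - replace (- (2 * th ^ 2)) with (2 * (- (th * th ^ 2)) * / th) by (field; lra).
    apply Rmult_le_compat_r; lra.
  - replace 0 with (0 * / th) by ring. apply Rmult_le_compat_r; lra.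
  - replace (th / 2) with (2 * ((th / 2) * (th / 2)) * / th) by (field; lra).
    unfold Rdiv in *. rewrite Rminus_0_r. apply Rmult_le_compat_r; lra.
  - replace (2 * th) with (2 * (th * th) * / th) by (field; lra).
    unfold Rdiv. rewrite Rminus_0_r. apply Rmult_le_compat_r; lra.
Qed.

(** The deviation is bounded by the slope alone, so that only the orders of
    the two coordinates of the curve at [4] matter. *)
Lemma direction_near_Ci (x y : R) :
  0 < y -> Cmod ((x, y) / RtoC (Cmod (x, y)) - Ci)%C <= 2 * (Rabs x / y).
Proof.
  intros Hy. set (n := Cmod (x, y)).
  assert (Hn1 : y <= n).
  { eapply Rle_trans; [apply Rle_abs|]. apply (im_le_Cmod (x, y)). }
  assert (Hn2 := Cmod_le_abs x y). fold n in Hn2. rewrite (Rabs_right y) in Hn2 by lra.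
  assert (Hx := Rabs_pos x).
  assert (E : ((x, y) / RtoC n - Ci)%C = (x / n, - ((n - y) / n))).
  { unfold Cdiv. rewrite <- RtoC_inv by lra.
    unfold Ci, RtoC, Cmult, Cminus, Cplus, Copp. simpl. f_equal; field; lra. }
  rewrite E. eapply Rle_trans; [apply Cmod_le_abs|].
  rewrite Rabs_Ropp. unfold Rdiv. rewrite !Rabs_mult, Rabs_inv.
  rewrite (Rabs_right n), (Rabs_right (n - y)) by lra.
  assert (I : 0 < / n <= / y).
  { split; [apply Rinv_0_lt_compat; lra|apply Rinv_le_contravar; lra]. }
  assert (Rabs x * / n <= Rabs x * / y) by (apply Rmult_le_compat_l; lra).
  assert ((n - y) * / n <= Rabs x * / y) by (apply Rmult_le_compat; lra).
  lra.
Qed.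

Lemma trace_4_tangent_start : half_tangent trace_4 (at_right 0) (RtoC 4) Ci.
Proof.
  apply filterlim_Cmod; [typeclasses eauto|]. intros eps He.
  assert (H : at_right 0 (fun t => 0 < t < 1 /\
    Cmod ((trace_4 t - 4) / RtoC (Cmod (trace_4 t - 4)) - Ci)%C < eps)).
  { apply trace_4_start with
      (P := fun z => Cmod ((z - 4) / RtoC (Cmod (z - 4)) - Ci)%C < eps)
      (e := Rmin 1 (eps / 8)).
    { apply Rmin_pos; lra. }
    intros th Hth _.
    assert (e1 := Rmin_l 1 (eps / 8)). assert (e2 := Rmin_r 1 (eps / 8)).
    destruct (ray_curve_near_4 th ltac:(lra)) as [B1 B2].
    destruct (ray_curve th - 4)%C as [x y]. simpl in B1, B2.
    eapply Rle_lt_trans; [apply direction_near_Ci; lra|].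
    apply Rle_lt_trans with (8 * th); [|lra].
    rewrite Rabs_left1 by lra.
    apply Rmult_le_reg_r with y; [lra|].
    replace (2 * (- x / y) * y) with (2 * - x) by (field; lra). nra. }
  revert H. apply filter_imp. intros t [_ K]; exact K.
Qed.

Lemma trace_4_limit_start (eps : R) :
  0 < eps -> at_right 0 (fun t => 0 < t < 1 /\ Cmod (trace_4 t - 4) < eps).
Proof.
  intros He.
  apply trace_4_start with (P := fun z => Cmod (z - 4) < eps) (e := Rmin 1 (eps / 4)).
  { apply Rmin_pos; lra. }
  intros th Hth _.
  assert (e1 := Rmin_l 1 (eps / 4)). assert (e2 := Rmin_r 1 (eps / 4)).
  destruct (ray_curve_near_4 th ltac:(lra)) as [B1 B2].
  destruct (ray_curve th - 4)%C as [x y]. simpl in B1, B2.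
  eapply Rle_lt_trans; [apply Cmod_le_abs|].
  rewrite Rabs_left1, Rabs_right by lra. nra.
Qed.

(** The secant direction from [2] is exactly [exp (i th)], since
    [(exp (2 i th) - 1) / (i th) = 2 (sin th / th) exp (i th)]. *)
Lemma ray_curve_sub_2 (th : R) :
  0 < th < PI ->
  Cmod (ray_curve th - 2) = 2 * sin th / th /\
  ((ray_curve th - 2) / RtoC (Cmod (ray_curve th - 2)))%C = (cos th, sin th).
Proof.
  intros H. assert (Hs : 0 < sin th) by (apply sin_gt_0; lra).
  assert (Hr : 0 < 2 * sin th / th) by (apply Rdiv_lt_0_compat; lra).
  assert (E : (ray_curve th - 2)%C = (RtoC (2 * sin th / th) * (cos th, sin th))%C).
  { unfold ray_curve, RtoC, Cmult, Cminus, Cplus, Copp. simpl. f_equal; field; lra. }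
  assert (E1 : Cmod (cos th, sin th) = 1).
  { assert (Q := sin2_cos2 th). unfold Rsqr in Q.
    unfold Cmod. simpl. replace (_ + _) with 1 by lra. apply sqrt_1. }
  rewrite E, Cmod_mult, Cmod_R, E1, Rabs_right, Rmult_1_r by lra.
  split; [reflexivity|]. field. apply RtoC_neq_0. lra.
Qed.

Lemma trace_4_limit_end : filterlim trace_4 (at_left 1) (locally (RtoC 2)).
Proof.
  apply filterlim_Cmod; [typeclasses eauto|]. intros eps He. assert (HP := PI2_3_2).
  assert (H : at_left 1 (fun t => 0 < t < 1 /\ Cmod (trace_4 t - 2)%C < eps)).
  { apply trace_4_end with (P := fun z => Cmod (z - 2)%C < eps) (e := Rmin 1 (eps / 2)).
    { apply Rmin_pos; lra. }
    intros th Hth Hth0.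
    assert (e1 := Rmin_l 1 (eps / 2)). assert (e2 := Rmin_r 1 (eps / 2)).
    destruct (ray_curve_sub_2 th ltac:(lra)) as [-> _].
    assert (Hs := sin_lt_x (PI - th) ltac:(lra)). rewrite sin_PI_x in Hs.
    apply Rmult_lt_reg_r with th; [exact Hth0|].
    unfold Rdiv. rewrite Rmult_assoc, Rinv_l by lra.
    assert (eps * 1 <= eps * th) by (apply Rmult_le_compat_l; lra). lra. }
  revert H. apply filter_imp. intros t [_ K]; exact K.
Qed.

Lemma trace_4_tangent_end : half_tangent trace_4 (at_left 1) (RtoC 2) (RtoC (-1)).
Proof.
  apply filterlim_Cmod; [typeclasses eauto|]. intros eps He. assert (HP := PI2_3_2).
  assert (H : at_left 1 (fun t => 0 < t < 1 /\
    Cmod ((trace_4 t - 2) / RtoC (Cmod (trace_4 t - 2)) - RtoC (-1))%C < eps)).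
  { apply trace_4_end with
      (P := fun z => Cmod ((z - 2) / RtoC (Cmod (z - 2)) - RtoC (-1))%C < eps)
      (e := Rmin 1 (eps / 2)).
    { apply Rmin_pos; lra. }
    intros th Hth Hth0.
    assert (e1 := Rmin_l 1 (eps / 2)). assert (e2 := Rmin_r 1 (eps / 2)).
    destruct (ray_curve_sub_2 th ltac:(lra)) as [_ ->].
    set (eta := PI - th). assert (Heta : 0 < eta < 1) by (unfold eta; lra).
    assert (E1 : sin th = sin eta) by (unfold eta; symmetry; apply sin_PI_x).
    assert (E2 : cos th = - cos eta).
    { unfold eta. rewrite Rtrigo_facts.cos_pi_minus. ring. }
    assert (Hs := sin_lt_x eta ltac:(lra)).
    assert (Hs0 : 0 < sin eta) by (apply sin_gt_0; lra).
    assert (Hc := cos_ge_half eta ltac:(lra)). assert (C1 := COS_bound eta).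
    assert (Q := sin2_cos2 eta). unfold Rsqr in Q.
    rewrite E1, E2.
    assert (E : (((- cos eta)%R, sin eta) - RtoC (-1))%C = (1 - cos eta, sin eta)).
    { unfold RtoC, Cminus, Cplus, Copp. simpl. f_equal; ring. }
    rewrite E. eapply Rle_lt_trans; [apply Cmod_le_abs|].
    rewrite !Rabs_right by lra.
    assert (1 - cos eta <= eta) by nra. unfold eta in *. lra. }
  revert H. apply filter_imp. intros t [_ K]; exact K.
Qed.

Lemma trace_4_is_trace : is_trace (driving 4) trace_4.
Proof.
  split.
  - intros t Ht. apply filterlim_Cmod; [typeclasses eauto|]. intros eps He.
    destruct (Req_dec t 0) as [->|N].
    + rewrite trace_4_0. destruct (trace_4_limit_start eps He) as [d K].
      exists d.
      change (forall s : R, Rabs (s - 0) < d -> 0 <= s < 1 ->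
        Cmod (trace_4 s - 4) < eps).
      intros s Hs Hs'. destruct (Req_dec s 0) as [->|Ns].
      * rewrite trace_4_0. replace (4 - 4)%C with (RtoC 0) by ring.
        rewrite Cmod_0. exact He.
      * apply (K s Hs). lra.
    + assert (Ht' : 0 < t < 1) by lra. assert (Ht1 : t < 1) by lra.
      assert (A := deriv_along_plus _ _ _ _ _ _ _ _
        (deriv_along_const _ _ ((0, PI) : C))
        (deriv_along_scal _ _ _ _ _ (- RtoC 1)%C
          (deriv_shift (fun s => 0 <= s < 1) t Ht1))).
      assert (E : forall s, ((0, PI) + - RtoC 1 * RtoC (shift s))%C = (- shift s, PI)).
      { intros s. unfold RtoC, Cplus, Cmult, Copp. simpl. f_equal; ring. }
      rewrite E in A.
      assert (B := deriv_along_comp _ _ _ _ _ _ _ (vanishing_within _ t)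
        (complex_deriv_k_inv _ (ray_slit t Ht')) A).
      assert (K := deriv_along_cont _ _ _ _ _ (vanishing_within _ t) B eps He).
      assert (L : within (fun s => 0 <= s < 1) (locally t) (fun s => 0 < s)).
      { apply filter_le_within. apply (open_gt 0). lra. }
      generalize (filter_and _ _ K L). apply filter_imp. intros s [Ks Ls].
      rewrite !trace_4_pos by lra. rewrite <- E. exact Ks.
  - intros t Ht z. rewrite hull_4, arc_trace_4 by exact Ht. reflexivity.
Qed.

(** * The conformal maps [g] *)

Lemma arc_complement_trace (gam : R -> C) (t : R) (z : C) :
  is_trace (driving 4) gam -> 0 <= t < 1 ->
  (arc_complement gam t z <-> upper_half_plane z /\ shift_in_slit t z).
Proof.
  intros [_ Hh] Ht. unfold arc_complement. rewrite <- (Hh t Ht z), hull_4 by exact Ht.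
  split.
  - intros [Hz N]. split; [exact Hz|]. apply shift_in_slit_iff; [exact Ht|exact Hz|].
    intros E. apply N. split; assumption.
  - intros [Hz N]. split; [exact Hz|]. intros [_ E].
    apply shift_in_slit_iff in N; auto.
Qed.

Lemma k_inv_slit_inj (p q : C) :
  slit_half_plane p -> slit_half_plane q -> k_inv p = k_inv q -> p = q.
Proof.
  intros Hp Hq E. destruct (k_inv_spec p Hp) as [_ <-].
  destruct (k_inv_spec q Hq) as [_ E']. rewrite E. exact E'.
Qed.

Lemma g_conformal (t : R) :
  0 <= t < 1 ->
  conformal_onto (g t) (fun z => upper_half_plane z /\ shift_in_slit t z) upper_half_plane.
Proof.
  intros Ht. assert (Nc := scale_neq_0 t ltac:(lra)).
  split; [|split].
  - intros z [Hz Hp]. destruct (k_inv_spec _ Hp) as [Hz' _].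
    assert (A := deriv_along_plus _ _ _ _ _ _ _ _ (complex_deriv_k z Hz)
      (deriv_along_const _ _ (RtoC (shift t)))).
    assert (B := deriv_along_scal _ _ _ _ _ (scale t)
      (deriv_along_comp _ _ _ _ _ _ _ (vanishing_locally z)
        (complex_deriv_k_inv _ Hp) A)).
    eexists. split; [apply complex_deriv_is_derive; exact B|].
    assert (Inz : forall x, x <> RtoC 0 -> (/ x)%C <> RtoC 0).
    { intros x Hx E. apply C1_nz. rewrite <- (Cinv_r x Hx), E. ring. }
    rewrite Cplus_0_r.
    unfold Cdiv. repeat first [apply Cmult_neq_0 | apply Inz];
      first [exact Nc | apply sub_2_neq_0; assumption | apply sub_4_neq_0; assumption].
  - intros z1 z2 [H1 P1] [H2 P2] E. rewrite !g_eq in E.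
    apply (f_equal (Cmult (/ scale t))) in E.
    rewrite !Cmult_assoc, Cinv_l, !Cmult_1_l in E by exact Nc.
    apply k_inv_slit_inj in E; [|exact P1|exact P2].
    apply k_inj; [exact H1|exact H2|].
    replace (k z1) with (k z1 + RtoC (shift t) - RtoC (shift t))%C by ring.
    rewrite E. ring.
  - intros w. split.
    + intros Hw.
      assert (Hw' := upper_unscale t w ltac:(lra) Hw).
      assert (Hk := k_slit _ Hw'). set (w' := (w / scale t)%C) in *.
      assert (Hs : slit_half_plane (k w' + RtoC (- shift t))%C).
      { destruct (slit_elim _ Hk) as [K1 K2]. apply slit_iff.
        rewrite im_plus, re_plus, im_RtoC, re_RtoC, Rplus_0_r. split; [exact K1|].
        intros E. assert (K := K2 E). assert (L := shift_antitone 0 t ltac:(lra) ltac:(lra)).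
        rewrite shift_0 in L. lra. }
      destruct (k_inv_spec _ Hs) as [Hz Ez].
      exists (k_inv (k w' + RtoC (- shift t))%C).
      assert (E : (k (k_inv (k w' + RtoC (- shift t))) + RtoC (shift t))%C = k w').
      { rewrite Ez, RtoC_opp. ring. }
      split; [split; [exact Hz|]|].
      * unfold shift_in_slit. rewrite E. exact Hk.
      * rewrite g_eq, E, k_inv_k by exact Hw'. unfold w'. field. exact Nc.
    + intros [z [[_ Hp] <-]]. apply g_upper; [lra|exact Hp].
Qed.

Lemma driving_4_bound (t : R) : 0 <= t < 1 -> Cmod (RtoC (driving 4 t)) <= 4.
Proof.
  intros H. rewrite Cmod_R. unfold driving.
  assert (K := sqrt_pos (1 - t)).
  assert (K' : sqrt (1 - t) <= 1).
  { rewrite <- sqrt_1 at 2. apply sqrt_le_1; lra. }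
  rewrite Rabs_right by lra. lra.
Qed.

(** Far from the driving point the velocity is small, so by the first-exit
    argument the orbit stays within distance [1] of its start. *)
Lemma g_stays_near (t : R) (z : C) :
  0 <= t < 1 -> upper_half_plane z -> shift_in_slit t z -> 10 <= Cmod z ->
  Cmod (g t z - z) < 1.
Proof.
  intros Ht Hz Hp Hr. apply Rnot_le_lt. intros L.
  assert (Hsl : forall s, 0 <= s <= t -> shift_in_slit s z).
  { intros s Hs. apply shift_in_slit_mono with t; auto; lra. }
  assert (Hd : forall D s, 0 <= s <= t ->
    deriv_within D (fun r => g r z) s (2 / (g s z - RtoC (driving 4 s)))%C).
  { intros D s Hs. apply g_loewner; [lra|apply Hsl, Hs]. }
  destruct (first_exit (fun s => Cmod (g s z - z)) t 1) as [s [Hs [Es Hlt]]].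
  - lra.
  - intros s Hs eps He.
    destruct (deriv_within_cont _ _ _ _ (Hd (fun x => 0 <= x <= t) s Hs) eps He)
      as [d [Hd0 K]].
    exists d. split; [exact Hd0|]. intros r Hrt Hrs.
    eapply Rle_lt_trans; [|exact (K r Hrt Hrs)].
    assert (T1 := Cmod_sub_ge (g r z - z) (g s z - z)).
    assert (T2 := Cmod_sub_ge (g s z - z) (g r z - z)).
    replace (g r z - z - (g s z - z))%C with (g r z - g s z)%C in T1 by ring.
    replace (g s z - z - (g r z - z))%C with (- (g r z - g s z))%C in T2 by ring.
    rewrite Cmod_opp in T2. apply Rabs_le. lra.
  - rewrite g_0 by exact Hz. replace (z - z)%C with (RtoC 0) by ring.
    rewrite Cmod_0. lra.
  - exact L.
  - assert (M := mean_value_ineq_within (fun r => g r z)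
      (fun r => 2 / (g r z - RtoC (driving 4 r)))%C 0 s (2 / 5) ltac:(lra)).
    cbv beta in M. rewrite (g_0 z Hz), Es in M.
    assert (1 <= 2 / 5 * (s - 0)); [|lra]. apply M.
    + intros r Hrs. apply Hd. lra.
    + intros r Hrs.
      assert (Hnear : Cmod (g r z - z) <= 1).
      { destruct (Req_dec r s) as [->|N]; [lra|]. apply Rlt_le, Hlt. lra. }
      assert (T := Cmod_sub_ge z (RtoC (driving 4 r) - (g r z - z))).
      replace (z - (RtoC (driving 4 r) - (g r z - z)))%C
        with (g r z - RtoC (driving 4 r))%C in T by ring.
      assert (T2 := Cmod_triangle (RtoC (driving 4 r)) (- (g r z - z))).
      rewrite Cmod_opp in T2.
      assert (D4 := driving_4_bound r ltac:(lra)).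
      change (RtoC (driving 4 r) + - (g r z - z))%C
        with (RtoC (driving 4 r) - (g r z - z))%C in T2.
      set (v := (g r z - RtoC (driving 4 r))%C) in *.
      assert (Hv : 5 <= Cmod v) by lra.
      rewrite Cmod_div by (apply Cmod_gt_0; lra).
      rewrite Cmod_R, Rabs_right by lra. unfold Rdiv.
      apply Rmult_le_compat_l; [lra|]. apply Rinv_le_contravar; lra.
Qed.

(** Integrating [dg/ds - 2 / z], of size [O (1 / |z|^2)] on an orbit that stays
    near [z]. *)
Lemma g_hydrodynamic (t : R) :
  0 <= t < 1 ->
  hydrodynamic (g t) (fun z => upper_half_plane z /\ shift_in_slit t z) t.
Proof.
  intros Ht. exists 20, 10. split; [lra|]. intros z [Hz Hp] Hr.
  assert (Nz := upper_neq_0 z Hz).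
  assert (Hz2 : 0 < Cmod z ^ 2) by (apply pow_lt; lra).
  assert (HM : 0 < 20 / Cmod z ^ 2) by (apply Rdiv_lt_0_compat; lra).
  destruct (Req_dec t 0) as [->|Nt].
  { rewrite g_0 by exact Hz. rewrite Rmult_0_r.
    replace (z - z - 0 / z)%C with (RtoC 0) by (field; exact Nz).
    rewrite Cmod_0. lra. }
  assert (Hsl : forall s, 0 <= s <= t -> shift_in_slit s z).
  { intros s Hs. apply shift_in_slit_mono with t; auto; lra. }
  assert (M := mean_value_ineq_within
    (fun s => g s z - (2 / z) * RtoC s)%C
    (fun s => 2 / (g s z - RtoC (driving 4 s)) - (2 / z) * RtoC 1)%C 0 t
    (20 / Cmod z ^ 2) ltac:(lra)).
  cbv beta in M. rewrite (g_0 z Hz) in M.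
  replace (g t z - 2 / z * RtoC t - (z - 2 / z * RtoC 0))%C
    with (g t z - z - RtoC (2 * t) / z)%C in M
    by (rewrite RtoC_mult; field; exact Nz).
  eapply Rle_trans; [apply M|].
  - intros s Hs. apply deriv_along_minus; [typeclasses eauto| |].
    + apply g_loewner; [lra|apply Hsl, Hs].
    + apply deriv_along_scal; [typeclasses eauto|apply deriv_within_var].
  - intros s Hs. assert (Hnear := g_stays_near s z ltac:(lra) Hz (Hsl s Hs) Hr).
    assert (D4 := driving_4_bound s ltac:(lra)).
    set (v := (g s z - RtoC (driving 4 s))%C).
    assert (Hdist : Cmod (z - v) <= 5).
    { replace (z - v)%C with (RtoC (driving 4 s) + - (g s z - z))%C by (unfold v; ring).
      eapply Rle_trans; [apply Cmod_triangle|]. rewrite Cmod_opp. lra. }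
    assert (Hv : Cmod z / 2 <= Cmod v).
    { assert (T := Cmod_sub_ge z (z - v)).
      replace (z - (z - v))%C with v in T by ring. lra. }
    assert (Nv : v <> RtoC 0) by (apply Cmod_gt_0; lra).
    replace (2 / v - 2 / z * RtoC 1)%C with (2 * (z - v) / (z * v))%C
      by (field; split; assumption).
    rewrite Cmod_div by (apply Cmult_neq_0; assumption).
    rewrite !Cmod_mult, Cmod_R, Rabs_right by lra.
    replace (20 / Cmod z ^ 2) with (2 * 5 * / (Cmod z * (Cmod z / 2))) by (field; lra).
    assert (Q : 0 < Cmod z * (Cmod z / 2)) by (apply Rmult_lt_0_compat; lra).
    unfold Rdiv at 1. apply Rmult_le_compat.
    + assert (K := Cmod_ge_0 (z - v)). lra.
    + apply Rlt_le, Rinv_0_lt_compat. apply Rmult_lt_0_compat; lra.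
    + lra.
    + apply Rinv_le_contravar; [exact Q|]. apply Rmult_le_compat_l; lra.
  - rewrite Rminus_0_r. rewrite <- (Rmult_1_r (20 / Cmod z ^ 2)) at 2.
    apply Rmult_le_compat_l; lra.
Qed.

Lemma conformal_onto_ext (f : C -> C) (U U' V : C -> Prop) :
  (forall z, U z <-> U' z) -> conformal_onto f U V -> conformal_onto f U' V.
Proof.
  intros E [H1 [H2 H3]]. split; [|split].
  - intros z Hz. apply H1, E, Hz.
  - intros z1 z2 Hz1 Hz2. apply H2; apply E; assumption.
  - intros w. rewrite H3. split; intros [z [Hz K]]; exists z; split; auto; apply E, Hz.
Qed.

Lemma g_loewner_chain (gam : R -> C) :
  is_trace (driving 4) gam -> loewner_chain (driving 4) gam g.
Proof.
  intros Hg. split; [exact g_0|]. intros t Ht.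
  assert (E := fun z => arc_complement_trace gam t z Hg Ht).
  split; [|split].
  - apply conformal_onto_ext with (2 := g_conformal t Ht). intros z. symmetry. apply E.
  - destruct (g_hydrodynamic t Ht) as [M [r [Hr K]]]. exists M, r.
    split; [exact Hr|]. intros z Hz. apply K, E, Hz.
  - intros z Hz. apply E in Hz. destruct Hz as [Hz Hp]. split.
    + apply upper_neq_real, g_upper; [lra|exact Hp].
    + apply deriv_within_is_derive_within; [exact Ht|].
      apply g_loewner; [lra|exact Hp].
Qed.

(** * Uniqueness of the trace *)

(** The arcs increase, so an injective trace is recovered from them:
    [gam1 t] is the point of the arc up to [t] that belongs to no shorter arc. *)
Lemma trace_unique (lam : R -> R) (gam1 gam2 : R -> C) :
  is_trace lam gam1 -> is_trace lam gam2 ->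
  (forall s t, 0 < s < 1 -> 0 < t < 1 -> gam1 s = gam1 t -> s = t) ->
  forall t, 0 <= t < 1 -> gam2 t = gam1 t.
Proof.
  intros [C1 H1] [C2 H2] Hinj.
  assert (Hpos : forall t, 0 < t < 1 -> gam2 t = gam1 t).
  { intros t Ht.
    assert (E : forall s z, 0 <= s < 1 -> (arc gam1 s z <-> arc gam2 s z)).
    { intros s z Hs. rewrite <- (H1 s Hs z), <- (H2 s Hs z). reflexivity. }
    destruct (proj1 (E t (gam1 t) ltac:(lra))) as [r [Hr Er]].
    { exists t. split; [lra|reflexivity]. }
    destruct (proj2 (E r (gam1 t) ltac:(lra))) as [q [Hq Eq]].
    { exists r. split; [lra|exact Er]. }
    apply Hinj in Eq; [|lra|lra].
    assert (r = t) by lra. subst r. symmetry. exact Er. }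
  intros t Ht. destruct (Req_dec t 0) as [->|N]; [|apply Hpos; lra].
  apply Ceq_minus. apply NNPP. intros N.
  assert (Hm := proj1 (Cmod_gt_0 _) N). set (m := Cmod (gam2 0 - gam1 0)) in *.
  assert (D1 := proj1 (filterlim_Cmod _ _ _) (C1 0 Ht) (m / 2) ltac:(lra)).
  assert (D2 := proj1 (filterlim_Cmod _ _ _) (C2 0 Ht) (m / 2) ltac:(lra)).
  destruct (filter_and _ _ D1 D2) as [d K].
  set (s := Rmin (d / 2) (1 / 2)).
  assert (Hd := cond_pos d).
  assert (Hs : 0 < s) by (apply Rmin_pos; lra).
  assert (s1 : s <= d / 2) by apply Rmin_l. assert (s2 : s <= 1 / 2) by apply Rmin_r.
  destruct (K s) as [K1 K2].
  { change (Rabs (s - 0) < d). rewrite Rminus_0_r, Rabs_right by lra. lra. }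
  { lra. }
  rewrite Hpos in K2 by lra.
  assert (T := Cmod_triangle (gam1 s - gam1 0) (- (gam1 s - gam2 0))).
  rewrite Cmod_opp in T.
  replace (gam1 s - gam1 0 + - (gam1 s - gam2 0))%C with (gam2 0 - gam1 0)%C in T by ring.
  fold m in T. lra.
Qed.

(** * Reflection *)

Lemma reflect_involutive (z : C) : reflect (reflect z) = z.
Proof. destruct z as [x y]. unfold reflect, Cconj, Copp. simpl. f_equal; ring. Qed.

Lemma reflect_upper (z : C) : upper_half_plane (reflect z) <-> upper_half_plane z.
Proof.
  unfold upper_half_plane, reflect. rewrite im_opp, im_conj, Ropp_involutive. reflexivity.
Qed.

Lemma Cmod_reflect (z : C) : Cmod (reflect z) = Cmod z.
Proof. unfold reflect. rewrite Cmod_opp. apply Cmod_conj. Qed.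

Lemma reflect_minus (a b : C) : reflect (a - b)%C = (reflect a - reflect b)%C.
Proof.
  destruct a, b. unfold reflect, Cconj, Cminus, Cplus, Copp. simpl. f_equal; ring.
Qed.

Lemma reflect_RtoC (x : R) : reflect (RtoC x) = RtoC (- x).
Proof. unfold reflect, Cconj, Copp, RtoC. simpl. f_equal; ring. Qed.

Lemma reflect_mult_RtoC (a : C) (x : R) :
  reflect (a * RtoC x)%C = (reflect a * RtoC x)%C.
Proof. destruct a. unfold reflect, Cconj, Cmult, Copp, RtoC. simpl. f_equal; ring. Qed.

Lemma reflect_div (x : R) (v : C) :
  v <> RtoC 0 -> reflect (RtoC x / v)%C = (RtoC x / reflect v)%C.
Proof.
  intros H. unfold reflect. rewrite Cdiv_conj by exact H.
  replace (Cconj (RtoC x)) with (RtoC x)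
    by (unfold Cconj, RtoC; simpl; f_equal; ring).
  field. intros E. apply H. apply Cmod_eq_0. rewrite <- Cmod_conj, E. apply Cmod_0.
Qed.

Lemma deriv_within_reflect (D : R -> Prop) (u : R -> C) (t : R) (l : C) :
  deriv_within D u t l -> deriv_within D (fun s => reflect (u s)) t (reflect l).
Proof.
  intros H eps He. generalize (H eps He). apply filter_imp. intros s Hs.
  rewrite <- reflect_mult_RtoC, <- !reflect_minus, Cmod_reflect. exact Hs.
Qed.

Lemma filterlim_reflect {T : Type} (F : (T -> Prop) -> Prop) {FF : Filter F}
  (f : T -> C) (a : C) :
  filterlim f F (locally a) -> filterlim (fun x => reflect (f x)) F (locally (reflect a)).
Proof.
  intros H. apply filterlim_Cmod; [exact FF|]. intros eps He.
  generalize (proj1 (filterlim_Cmod _ _ _) H eps He). apply filter_imp. intros x Hx.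
  rewrite <- reflect_minus, Cmod_reflect. exact Hx.
Qed.

Lemma reflect_velocity (a : C) (l : R) :
  a <> RtoC l -> reflect (2 / (a - RtoC l))%C = (2 / (reflect a - RtoC (- l)))%C.
Proof.
  intros H. rewrite reflect_div by (apply Cminus_eq_contra, H).
  rewrite reflect_minus, reflect_RtoC. reflexivity.
Qed.

Lemma reflect_neq (a : C) (l : R) : a <> RtoC l -> reflect a <> RtoC (- l).
Proof.
  intros H E. apply H. rewrite <- (reflect_involutive a), E, reflect_RtoC.
  f_equal. ring.
Qed.

Lemma loewner_solution_reflect (lam lam' : R -> R) (z : C) (t : R) (u : R -> C) :
  (forall s, lam' s = - lam s) -> loewner_solution lam z t u ->
  loewner_solution lam' (reflect z) t (fun s => reflect (u s)).
Proof.
  intros Hl [H0 Hu]. split; [rewrite H0; reflexivity|].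
  intros s Hs. destruct (Hu s Hs) as [N D]. rewrite Hl. split.
  - apply reflect_neq, N.
  - rewrite <- reflect_velocity by exact N.
    apply deriv_within_is_derive_within; [exact Hs|].
    apply deriv_within_reflect. apply deriv_within_is_derive_within in D; [|exact Hs].
    exact D.
Qed.

Lemma loewner_hull_reflect (lam lam' : R -> R) (t : R) (z : C) :
  (forall s, lam' s = - lam s) ->
  (loewner_hull lam' t z <-> loewner_hull lam t (reflect z)).
Proof.
  intros Hl. unfold loewner_hull. rewrite reflect_upper.
  assert (Hl' : forall s, lam s = - lam' s) by (intros s; rewrite Hl; ring).
  split; intros [Hz N]; split; try exact Hz; intros [u Hu]; apply N.
  - exists (fun s => reflect (u s)). rewrite <- (reflect_involutive z).
    apply (loewner_solution_reflect lam lam'); assumption.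
  - exists (fun s => reflect (u s)). apply (loewner_solution_reflect lam' lam); assumption.
Qed.

Lemma arc_reflect (gam : R -> C) (t : R) (z : C) :
  arc (fun s => reflect (gam s)) t z <-> arc gam t (reflect z).
Proof.
  split; intros [s [Hs E]]; exists s; split; try exact Hs.
  - rewrite E. apply reflect_involutive.
  - rewrite <- E. symmetry. apply reflect_involutive.
Qed.

Lemma is_trace_reflect (lam lam' : R -> R) (gam : R -> C) :
  (forall s, lam' s = - lam s) -> is_trace lam gam ->
  is_trace lam' (fun t => reflect (gam t)).
Proof.
  intros Hl [Hc Hh]. split.
  - intros t Ht. apply filterlim_reflect; [typeclasses eauto|]. apply Hc, Ht.
  - intros t Ht z. rewrite arc_reflect, <- (Hh t Ht). apply loewner_hull_reflect, Hl.
Qed.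

Lemma complex_deriv_reflect (f : C -> C) (z l : C) :
  complex_deriv f (reflect z) l ->
  complex_deriv (fun x => reflect (f (reflect x))) z (Cconj l).
Proof.
  intros H eps He. apply locally_Cmod.
  destruct (proj1 (locally_Cmod _ _) (H eps He)) as [d [Hd K]].
  exists d. split; [exact Hd|]. intros x Hx.
  rewrite <- Cmod_reflect, reflect_minus in Hx. specialize (K _ Hx).
  rewrite <- reflect_minus, Cmod_reflect in K.
  replace (reflect (f (reflect x)) - reflect (f (reflect z)) - Cconj l * (x - z))%C
    with (reflect (f (reflect x) - f (reflect z) - l * reflect (x - z))).
  - rewrite Cmod_reflect. exact K.
  - rewrite !reflect_minus. f_equal. destruct l, x, z.
    unfold reflect, Cconj, Cmult, Cminus, Cplus, Copp. simpl. f_equal; f_equal; ring.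
Qed.

Lemma loewner_chain_reflect (lam lam' : R -> R) (gam : R -> C) (G : R -> C -> C) :
  (forall s, lam' s = - lam s) -> loewner_chain lam gam G ->
  loewner_chain lam' (fun t => reflect (gam t)) (fun t z => reflect (G t (reflect z))).
Proof.
  intros Hl [H0 H].
  assert (Ec : forall t z, arc_complement (fun t => reflect (gam t)) t z <->
                           arc_complement gam t (reflect z)).
  { intros t z. unfold arc_complement. rewrite arc_reflect, reflect_upper. reflexivity. }
  split.
  - intros z Hz. rewrite H0 by (apply reflect_upper, Hz). apply reflect_involutive.
  - intros t Ht. destruct (H t Ht) as [[A1 [A2 A3]] [[M [r [Hr B]]] D]].
    split; [split; [|split]|split].
    + intros z Hz. apply Ec in Hz. destruct (A1 _ Hz) as [l [Dl Nl]].
      exists (Cconj l). split.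
      * apply complex_deriv_is_derive. apply complex_deriv_reflect.
        apply complex_deriv_is_derive, Dl.
      * intros E. apply Nl, Cmod_eq_0. rewrite <- Cmod_conj, E. apply Cmod_0.
    + intros z1 z2 Hz1 Hz2 E. apply Ec in Hz1; apply Ec in Hz2.
      apply (f_equal reflect) in E. rewrite !reflect_involutive in E.
      apply A2 in E; auto. apply (f_equal reflect) in E.
      rewrite !reflect_involutive in E. exact E.
    + intros w. rewrite <- reflect_upper, A3. split.
      * intros [z [Hz E]]. exists (reflect z). rewrite Ec, reflect_involutive, E.
        split; [exact Hz|apply reflect_involutive].
      * intros [z [Hz E]]. exists (reflect z). split; [apply Ec, Hz|].
        rewrite <- E. symmetry. apply reflect_involutive.
    + exists M, r. split; [exact Hr|]. intros z Hz Hrz. apply Ec in Hz.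
      rewrite <- Cmod_reflect in Hrz |- *. specialize (B _ Hz Hrz).
      rewrite <- (Cmod_reflect z). rewrite !reflect_minus, reflect_involutive.
      assert (Nz : z <> RtoC 0).
      { apply upper_neq_0. apply reflect_upper, Hz. }
      rewrite reflect_div by exact Nz. exact B.
    + intros z Hz. apply Ec in Hz. destruct (D _ Hz) as [N Dz]. rewrite Hl. split.
      * apply reflect_neq, N.
      * rewrite <- reflect_velocity by exact N.
        apply deriv_within_is_derive_within; [exact Ht|].
        apply deriv_within_is_derive_within in Dz; [|exact Ht].
        apply (deriv_within_reflect _ (fun s => G s (reflect z))), Dz.
Qed.

Lemma driving_opp (t : R) : driving (-4) t = - driving 4 t.
Proof. unfold driving. ring. Qed.

(** * The theorem *)

Theorem proposition3p4 :
  conformal_onto k upper_half_plane slit_half_plane /\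
  (exists gam : R -> C, is_trace (driving 4) gam) /\
  (forall gam : R -> C, is_trace (driving 4) gam ->
     loewner_chain (driving 4) gam g /\
     (forall z : C,
        (exists t : R, 0 < t < 1 /\ z = gam t) <->
        (upper_half_plane z /\
         exists x : R, 0 < x /\ k z = (RtoC x + PI * Ci)%C)) /\
     gam 0 = RtoC 4 /\
     (exists d : C, half_tangent gam (at_right 0) (RtoC 4) d /\ Re d = 0) /\
     filterlim gam (at_left 1) (locally (RtoC 2)) /\
     (exists d : C, half_tangent gam (at_left 1) (RtoC 2) d /\ Im d = 0) /\
     is_trace (driving (-4)) (fun t => reflect (gam t)) /\
     (forall gam' : R -> C, is_trace (driving (-4)) gam' ->
        forall t : R, 0 <= t < 1 -> gam' t = reflect (gam t)) /\
     loewner_chain (driving (-4)) (fun t => reflect (gam t))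
       (fun t z => reflect (g t (reflect z)))).
Proof.
  split; [exact k_conformal|]. split; [exists trace_4; exact trace_4_is_trace|].
  intros gam Hg.
  assert (E : forall t, 0 <= t < 1 -> gam t = trace_4 t).
  { apply (trace_unique _ _ _ trace_4_is_trace Hg trace_4_inj). }
  assert (Er : at_right 0 (fun t => trace_4 t = gam t)).
  { exists (mkposreal 1 Rlt_0_1). intros t Ht Ht0. symmetry. apply E.
    change (Rabs (t - 0) < 1) in Ht. rewrite Rminus_0_r, Rabs_right in Ht by lra. lra. }
  assert (El : at_left 1 (fun t => trace_4 t = gam t)).
  { exists (mkposreal 1 Rlt_0_1). intros t Ht Ht0. symmetry. apply E.
    change (Rabs (t - 1) < 1) in Ht. rewrite Rabs_left in Ht by lra. lra. }
  assert (Et : forall (F : (R -> Prop) -> Prop) (FF : Filter F) (p d : C),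
    F (fun t => trace_4 t = gam t) -> half_tangent trace_4 F p d -> half_tangent gam F p d).
  { intros F FF p d EF. apply filterlim_ext_loc. revert EF. apply filter_imp.
    intros t ->. reflexivity. }
  assert (Hchain := g_loewner_chain gam Hg).
  repeat match goal with |- _ /\ _ => split end.
  - exact Hchain.
  - intros z.
    assert (Ez : forall x, (RtoC x + PI * Ci)%C = (x, PI)).
    { intros x. unfold RtoC, Ci, Cplus, Cmult. simpl. f_equal; ring. }
    split.
    + intros [t [Ht ->]]. rewrite E by lra. destruct (trace_4_spec t Ht) as [H1 H2].
      split; [exact H1|]. exists (- shift t). rewrite Ez.
      split; [assert (K := shift_neg t Ht); lra|exact H2].
    + intros [Hz [x [Hx Ek]]]. rewrite Ez in Ek.
      destruct (shift_onto x Hx) as [s [Hs Es]].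
      exists s. split; [exact Hs|]. rewrite E by lra.
      rewrite trace_4_pos, Es, Ropp_involutive, <- Ek by lra. symmetry. apply k_inv_k, Hz.
  - rewrite E by lra. apply trace_4_0.
  - exists Ci. split; [|reflexivity].
    apply Et; [typeclasses eauto|exact Er|exact trace_4_tangent_start].
  - apply (filterlim_ext_loc _ _ El), trace_4_limit_end.
  - exists (RtoC (-1)). split; [|reflexivity].
    apply Et; [typeclasses eauto|exact El|exact trace_4_tangent_end].
  - apply (is_trace_reflect (driving 4)); [exact driving_opp|exact Hg].
  - intros gam' Hg' t Ht.
    assert (Hr : is_trace (driving 4) (fun t => reflect (gam' t))).
    { apply (is_trace_reflect (driving (-4))); [|exact Hg'].
      intros s. rewrite driving_opp. ring. }
    rewrite E by exact Ht.
    rewrite <- (trace_unique _ _ _ trace_4_is_trace Hr trace_4_inj t Ht).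
    symmetry. apply reflect_involutive.
  - apply (loewner_chain_reflect (driving 4)); [exact driving_opp|exact Hchain].
Qed.
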